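(* Let $\mathbb{C}$ be an algebraically coherent semi-abelian category or, more generally, a semi-abelian category satisfying the following conditions: (a) for every object $C$ of $\mathbb{C}$ and all subobjects $K,L\leq S\leq C$ such that $K$ and $L$ are normal in $C$, one has $[K,L]_S=[K,L]_C$ in $\mathbf{Sub}(C)$; (b)(i) for every object $C$ and all normal subobjects $K,L,M$ of $C$, $[K,L\vee M]_C=[K,L]_C\vee[K,M]_C$ in $\mathbf{Sub}(C)$; (b)(ii) for every object $C$ and all normal subobjects $K,L,M$ of $C$, $[K,[L,M]_C]_C\leq [[K,L]_C,M]_C\vee[L,[K,M]_C]_C$ in $\mathbf{Sub}(C)$. Let $p:E\to B$ be an extension (that is, a regular epimorphism) of a nilpotent object $B$ in $\mathbb{C}$. If the kernel of $p$ is contained in the Huq commutator $[N,N]_N$ of a nilpotent normal subobject $N$ of $E$, then $E$ is nilpotent. Furthermore, if $N$ is of nilpotency class $c$ and $B$ is of nilpotency class $d$, then $E$ is of nilpotency class at most $\frac{c(c+1)}{2}(d-1)+c$.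
   Context: A category is semi-abelian if it is pointed, Barr-exact, Bourn protomodular and has finite coproducts. Algebraic coherence (Cigoli–Gray–Van der Linden): for an object $X$ of a category with finite limits, $\mathrm{Pt}_X(\mathbb{C})$ denotes the category of points over $X$, i.e. of split epimorphisms with codomain $X$ together with a chosen splitting. A functor between categories with finite limits is coherent if it preserves finite limits and jointly strongly epimorphic pairs of morphisms. A category $\mathbb{C}$ with finite limits is algebraically coherent if for each morphism $f:X\to Y$ the change-of-base (pullback) functor $f^*:\mathrm{Pt}_Y(\mathbb{C})\to\mathrm{Pt}_X(\mathbb{C})$ is coherent. It is a known theorem of Cigoli, Gray and Van der Linden that every algebraically coherent semi-abelian category satisfies conditions (a), (b)(i), (b)(ii) of the claim. Let $\mathbb{C}$ be semi-abelian. Morphisms $f:A\to C$ and $g:B\to C$ commute if there is a (necessarily unique) morphism $\varphi:A\times B\to C$ with $\varphi\langle 1,0\rangle=f$ and $\varphi\langle 0,1\rangle=g$, where $\langle 1,0\rangle:A\to A\times B$ and $\langle 0,1\rangle:B\to A\times B$ are the canonical morphisms whose components are identities and zero morphisms. A normal subobject of $C$ is a subobject represented by a kernel of some morphism with domain $C$. The Huq commutator of $f:A\to C$ and $g:B\to C$ is the smallest normal subobject $N$ of $C$ such that $qf$ and $qg$ commute, where $q:C\to C/N$ is the cokernel of $N\to C$; it always exists in a semi-abelian category. For subobjects $S,T$ of $C$, $[S,T]_C$ denotes the Huq commutator of the monomorphisms $S\to C$ and $T\to C$. $\mathbf{Sub}(C)$ is the lattice of subobjects of $C$, with join $\vee$.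 If $S\leq C$, subobjects of $S$ are regarded as subobjects of $C$ by composition. For an object $C$ let $\gamma_C:\mathbf{Sub}(C)\to\mathbf{Sub}(C)$, $\gamma_C(S)=[C,S]_C$. The object $C$ is nilpotent if there is a non-negative integer $n$ with $\gamma_C^n(C)=0$; the least such $n$ is the nilpotency class of $C$.
   Formalization: The bound on the class of E is stated only when c > 0 or d = 0: for c = 0 and d ≥ 1 we have N = 0, so p is an isomorphism and E has class d, while the printed bound is 0. Nilpotency of E is proved without this restriction. *)

(* Defs.v *)
From Stdlib Require Import Classical ClassicalEpsilon.

Set Implicit Arguments.
Unset Strict Implicit.
Unset Printing Implicit Defensive.

Declare Scope cat_scope.
Delimit Scope cat_scope with cat.
Local Open Scope cat_scope.

Record Category : Type := MkCategory {
  Obj :> Type;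
  Hom : Obj -> Obj -> Type;
  idm : forall X, Hom X X;
  comp : forall X Y Z, Hom Y Z -> Hom X Y -> Hom X Z;
  comp_id_l : forall X Y (f : Hom X Y), comp (idm Y) f = f;
  comp_id_r : forall X Y (f : Hom X Y), comp f (idm X) = f;
  comp_assoc : forall W X Y Z (h : Hom Y Z) (g : Hom X Y) (f : Hom W X),
    comp h (comp g f) = comp (comp h g) f
}.

Arguments Hom {c} _ _.
Arguments idm {c} X.
Arguments comp {c X Y Z} _ _.

Notation "g ∘ f" := (comp g f) (at level 40, left associativity) : cat_scope.

Record Functor (C D : Category) : Type := MkFunctor {
  fobj :> C -> D;
  fmap : forall X Y : C, Hom X Y -> Hom (fobj X) (fobj Y);
  fmap_id : forall X : C, fmap (idm X) = idm (fobj X);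
  fmap_comp : forall (X Y Z : C) (g : Hom Y Z) (f : Hom X Y),
    fmap (g ∘ f) = fmap g ∘ fmap f
}.

Arguments fmap {C D} _ {X Y} _.

Definition is_mono {C : Category} {X Y : C} (m : Hom X Y) : Prop :=
  forall (T : C) (u v : Hom T X), m ∘ u = m ∘ v -> u = v.

Definition is_iso {C : Category} {X Y : C} (f : Hom X Y) : Prop :=
  exists g : Hom Y X, g ∘ f = idm X /\ f ∘ g = idm Y.

Definition is_terminal {C : Category} (X : C) : Prop :=
  forall T : C, exists! f : Hom T X, True.

Definition is_initial {C : Category} (X : C) : Prop :=
  forall T : C, exists! f : Hom X T, True.

Definition is_product {C : Category} {A B P : C}
    (p1 : Hom P A) (p2 : Hom P B) : Prop :=
  forall (T : C) (u : Hom T A) (v : Hom T B),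
    exists! w : Hom T P, p1 ∘ w = u /\ p2 ∘ w = v.

Definition is_coproduct {C : Category} {A B S : C}
    (i1 : Hom A S) (i2 : Hom B S) : Prop :=
  forall (T : C) (u : Hom A T) (v : Hom B T),
    exists! w : Hom S T, w ∘ i1 = u /\ w ∘ i2 = v.

Definition is_pullback {C : Category} {A B Z P : C}
    (f : Hom A Z) (g : Hom B Z) (p1 : Hom P A) (p2 : Hom P B) : Prop :=
  f ∘ p1 = g ∘ p2 /\
  forall (T : C) (u : Hom T A) (v : Hom T B), f ∘ u = g ∘ v ->
    exists! w : Hom T P, p1 ∘ w = u /\ p2 ∘ w = v.

Definition is_coequalizer {C : Category} {R X Q : C}
    (a b : Hom R X) (q : Hom X Q) : Prop :=
  q ∘ a = q ∘ b /\
  forall (T : C) (u : Hom X T), u ∘ a = u ∘ b -> exists! w : Hom Q T, w ∘ q = u.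

Definition is_regular_epi {C : Category} {X Q : C} (q : Hom X Q) : Prop :=
  exists (R : C) (a b : Hom R X), is_coequalizer a b q.

Definition is_kernel_pair {C : Category} {X Y R : C}
    (f : Hom X Y) (r1 r2 : Hom R X) : Prop :=
  is_pullback f f r1 r2.

(* Joint epimorphicity is not required separately: it follows from the lifting
   property as soon as equalizers exist. *)
Definition jointly_strongly_epi {C : Category} {A B X : C}
    (f : Hom A X) (g : Hom B X) : Prop :=
  forall (M D : C) (m : Hom M D) (h : Hom X D) (u : Hom A M) (v : Hom B M),
    is_mono m -> m ∘ u = h ∘ f -> m ∘ v = h ∘ g ->
    exists w : Hom X M, m ∘ w = h /\ w ∘ f = u /\ w ∘ g = v.

Record Pullback {C : Category} {A B Z : C} (f : Hom A Z) (g : Hom B Z) : Type :=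
  MkPullback {
    pb_obj : C;
    pb_fst : Hom pb_obj A;
    pb_snd : Hom pb_obj B;
    pb_is_pullback : is_pullback f g pb_fst pb_snd
  }.

(* All finite limits can be built from a terminal object and pullbacks. *)
Record has_finite_limits (C : Category) : Prop := {
  has_terminal : exists X : C, is_terminal X;
  has_pullbacks : forall (A B Z : C) (f : Hom A Z) (g : Hom B Z),
    inhabited (Pullback f g)
}.

Record has_finite_coproducts (C : Category) : Prop := {
  has_initial : exists X : C, is_initial X;
  has_binary_coproducts : forall A B : C,
    exists (S : C) (i1 : Hom A S) (i2 : Hom B S), is_coproduct i1 i2
}.

Record preserves_finite_limits {C D : Category} (F : Functor C D) : Prop := {
  preserves_terminal : forall X : C, is_terminal X -> is_terminal (F X);
  preserves_pullbacks : forall (A B Z P : C) (f : Hom A Z) (g : Hom B Z)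
      (p1 : Hom P A) (p2 : Hom P B),
    is_pullback f g p1 p2 ->
    is_pullback (fmap F f) (fmap F g) (fmap F p1) (fmap F p2)
}.

Definition coherent {C D : Category} (F : Functor C D) : Prop :=
  preserves_finite_limits F /\
  forall (A B X : C) (f : Hom A X) (g : Hom B X),
    jointly_strongly_epi f g -> jointly_strongly_epi (fmap F f) (fmap F g).

Definition reflects_isos {C D : Category} (F : Functor C D) : Prop :=
  forall (X Y : C) (f : Hom X Y), is_iso (fmap F f) -> is_iso f.

Record Point {C : Category} (X : C) : Type := MkPoint {
  pt_obj : C;
  pt_proj : Hom pt_obj X;
  pt_sec : Hom X pt_obj;
  pt_split : pt_proj ∘ pt_sec = idm X
}.

Record PointHom {C : Category} {X : C} (P Q : Point X) : Type := MkPointHom {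
  ph_mor : Hom (pt_obj P) (pt_obj Q);
  ph_proj : pt_proj Q ∘ ph_mor = pt_proj P;
  ph_sec : ph_mor ∘ pt_sec P = pt_sec Q
}.

Lemma point_hom_ext {C : Category} {X : C} (P Q : Point X) (f g : PointHom P Q) :
  ph_mor f = ph_mor g -> f = g.
Proof.
destruct f as [f f1 f2], g as [g g1 g2]; simpl; intros e; subst g.
rewrite (proof_irrelevance _ f1 g1), (proof_irrelevance _ f2 g2); reflexivity.
Qed.

Definition point_id {C : Category} {X : C} (P : Point X) : PointHom P P.
Proof.
exists (idm (pt_obj P)); [apply comp_id_r | apply comp_id_l].
Defined.

Definition point_comp {C : Category} {X : C} (P Q R : Point X)
    (g : PointHom Q R) (f : PointHom P Q) : PointHom P R.
Proof.
exists (ph_mor g ∘ ph_mor f).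
- rewrite comp_assoc, ph_proj; apply ph_proj.
- rewrite <- comp_assoc, ph_sec; apply ph_sec.
Defined.

Definition Pt {C : Category} (X : C) : Category.
Proof.
refine (@MkCategory (Point X) (@PointHom C X) (@point_id C X)
          (@point_comp C X) _ _ _).
- intros P Q f; apply point_hom_ext; simpl; apply comp_id_l.
- intros P Q f; apply point_hom_ext; simpl; apply comp_id_r.
- intros P Q R S h g f; apply point_hom_ext; simpl; apply comp_assoc.
Defined.

(* An arbitrary choice of pullbacks; another choice changes [change_of_base]
   below only up to natural isomorphism. *)
Definition pullback_of {C : Category} (H : has_finite_limits C) {A B Z : C}
    (f : Hom A Z) (g : Hom B Z) : Pullback f g :=
  epsilon (has_pullbacks H f g) (fun _ => True).

Definition pb_pair {C : Category} {A B Z : C} {f : Hom A Z} {g : Hom B Z}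
    (P : Pullback f g) {T : C} (u : Hom T A) (v : Hom T B)
    (e : f ∘ u = g ∘ v) : Hom T (pb_obj P) :=
  proj1_sig (constructive_indefinite_description _
    (proj2 (pb_is_pullback P) T u v e)).

Lemma pb_pair_fst {C : Category} {A B Z : C} {f : Hom A Z} {g : Hom B Z}
    (P : Pullback f g) {T : C} (u : Hom T A) (v : Hom T B)
    (e : f ∘ u = g ∘ v) : pb_fst P ∘ pb_pair P e = u.
Proof. unfold pb_pair; destruct constructive_indefinite_description as [w Hw]; apply Hw. Qed.

Lemma pb_pair_snd {C : Category} {A B Z : C} {f : Hom A Z} {g : Hom B Z}
    (P : Pullback f g) {T : C} (u : Hom T A) (v : Hom T B)
    (e : f ∘ u = g ∘ v) : pb_snd P ∘ pb_pair P e = v.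
Proof. unfold pb_pair; destruct constructive_indefinite_description as [w Hw]; apply Hw. Qed.

Lemma pb_ext {C : Category} {A B Z : C} {f : Hom A Z} {g : Hom B Z}
    (P : Pullback f g) {T : C} (w w' : Hom T (pb_obj P)) :
  pb_fst P ∘ w = pb_fst P ∘ w' -> pb_snd P ∘ w = pb_snd P ∘ w' -> w = w'.
Proof.
intros e1 e2; destruct (pb_is_pullback P) as [c U].
destruct (U T (pb_fst P ∘ w) (pb_snd P ∘ w)) as [x [_ Hx]].
- now rewrite !comp_assoc, c.
- rewrite <- (Hx w), <- (Hx w'); auto.
Qed.

Lemma base_sec_comm {C : Category} {X Y : C} (f : Hom X Y) (A : Point Y) :
  f ∘ idm X = pt_proj A ∘ (pt_sec A ∘ f).
Proof. rewrite comp_assoc, pt_split, comp_id_l; apply comp_id_r. Qed.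

Definition base_obj {C : Category} (H : has_finite_limits C) {X Y : C}
    (f : Hom X Y) (A : Point Y) : Point X :=
  let P := pullback_of H f (pt_proj A) in
  @MkPoint C X (pb_obj P) (pb_fst P) (pb_pair P (base_sec_comm f A))
    (pb_pair_fst P (base_sec_comm f A)).

Lemma base_map_comm {C : Category} {X Y : C} (f : Hom X Y) {A B : Point Y}
    (P : Pullback f (pt_proj A)) (h : PointHom A B) :
  f ∘ pb_fst P = pt_proj B ∘ (ph_mor h ∘ pb_snd P).
Proof.
rewrite comp_assoc, ph_proj; apply (proj1 (pb_is_pullback P)).
Qed.

Lemma base_map_sec {C : Category} {X Y : C} (f : Hom X Y) {A B : Point Y}
    (P : Pullback f (pt_proj A)) (Q : Pullback f (pt_proj B)) (h : PointHom A B) :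
  pb_pair Q (base_map_comm P h) ∘ pb_pair P (base_sec_comm f A) =
  pb_pair Q (base_sec_comm f B).
Proof.
apply pb_ext; rewrite comp_assoc.
- now rewrite !pb_pair_fst.
- rewrite !pb_pair_snd, <- comp_assoc, pb_pair_snd, comp_assoc, ph_sec.
  reflexivity.
Qed.

Definition base_map {C : Category} (H : has_finite_limits C) {X Y : C}
    (f : Hom X Y) (A B : Point Y) (h : PointHom A B) :
  PointHom (base_obj H f A) (base_obj H f B) :=
  let P := pullback_of H f (pt_proj A) in
  let Q := pullback_of H f (pt_proj B) in
  @MkPointHom C X (base_obj H f A) (base_obj H f B)
    (pb_pair Q (base_map_comm P h))
    (pb_pair_fst Q (base_map_comm P h)) (base_map_sec P Q h).

Lemma base_map_id {C : Category} {X Y : C} (f : Hom X Y) {A : Point Y}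
    (P : Pullback f (pt_proj A)) :
  pb_pair P (base_map_comm P (point_id A)) = idm (pb_obj P).
Proof.
apply pb_ext; rewrite ?pb_pair_fst, ?pb_pair_snd, comp_id_r; trivial.
apply comp_id_l.
Qed.

Lemma base_map_comp {C : Category} {X Y : C} (f : Hom X Y) {A B D : Point Y}
    (P : Pullback f (pt_proj A)) (Q : Pullback f (pt_proj B))
    (R : Pullback f (pt_proj D)) (g : PointHom B D) (h : PointHom A B) :
  pb_pair R (base_map_comm P (point_comp g h)) =
  pb_pair R (base_map_comm Q g) ∘ pb_pair Q (base_map_comm P h).
Proof.
apply pb_ext; rewrite comp_assoc.
- now rewrite !pb_pair_fst.
- rewrite !pb_pair_snd, <- (comp_assoc (ph_mor g)), pb_pair_snd.
  symmetry; apply comp_assoc.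
Qed.

Definition change_of_base {C : Category} (H : has_finite_limits C) {X Y : C}
    (f : Hom X Y) : Functor (Pt Y) (Pt X).
Proof.
refine (@MkFunctor (Pt Y) (Pt X) (base_obj H f) (@base_map C H X Y f) _ _).
- intros A; apply point_hom_ext; apply base_map_id.
- intros A B D g h; apply point_hom_ext; apply base_map_comp.
Defined.

Definition is_zero_object {C : Category} (Z : C) : Prop :=
  is_initial Z /\ is_terminal Z.

Definition pointed (C : Category) : Prop := exists Z : C, is_zero_object Z.

Record is_equivalence_relation {C : Category} {R X : C} (r1 r2 : Hom R X) : Prop := {
  er_jointly_mono : forall (T : C) (u v : Hom T R),
    r1 ∘ u = r1 ∘ v -> r2 ∘ u = r2 ∘ v -> u = v;
  er_refl : exists d : Hom X R, r1 ∘ d = idm X /\ r2 ∘ d = idm X;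
  er_sym : exists s : Hom R R, r1 ∘ s = r2 /\ r2 ∘ s = r1;
  er_trans : forall (P : C) (p1 p2 : Hom P R), is_pullback r2 r1 p1 p2 ->
    exists t : Hom P R, r1 ∘ t = r1 ∘ p1 /\ r2 ∘ t = r2 ∘ p2
}.

Record barr_exact (C : Category) : Prop := {
  ex_finite_limits : has_finite_limits C;
  ex_coequalizers : forall (X Y R : C) (f : Hom X Y) (r1 r2 : Hom R X),
    is_kernel_pair f r1 r2 ->
    exists (Q : C) (q : Hom X Q), is_coequalizer r1 r2 q;
  ex_stable : forall (A B Z P : C) (f : Hom A Z) (g : Hom B Z)
      (p1 : Hom P A) (p2 : Hom P B),
    is_pullback f g p1 p2 -> is_regular_epi g -> is_regular_epi p1;
  ex_effective : forall (R X : C) (r1 r2 : Hom R X),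
    is_equivalence_relation r1 r2 ->
    exists (Y : C) (f : Hom X Y), is_kernel_pair f r1 r2
}.

Definition protomodular (C : Category) (H : has_finite_limits C) : Prop :=
  forall (X Y : C) (f : Hom X Y), reflects_isos (change_of_base H f).

Record semi_abelian (C : Category) : Prop := {
  sa_pointed : pointed C;
  sa_exact : barr_exact C;
  sa_protomodular : protomodular (ex_finite_limits sa_exact);
  sa_coproducts : has_finite_coproducts C
}.

Definition algebraically_coherent (C : Category) : Prop :=
  exists H : has_finite_limits C,
    forall (X Y : C) (f : Hom X Y), coherent (change_of_base H f).

Definition is_zero {C : Category} {X Y : C} (f : Hom X Y) : Prop :=
  exists (Z : C) (a : Hom X Z) (b : Hom Z Y), is_zero_object Z /\ f = b ∘ a.

Definition is_kernel {C : Category} {K X Y : C} (f : Hom X Y) (k : Hom K X) : Prop :=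
  is_zero (f ∘ k) /\
  forall (T : C) (u : Hom T X), is_zero (f ∘ u) -> exists! w : Hom T K, k ∘ w = u.

Definition is_cokernel {C : Category} {X Y Q : C} (f : Hom X Y) (q : Hom Y Q) : Prop :=
  is_zero (q ∘ f) /\
  forall (T : C) (u : Hom Y T), is_zero (u ∘ f) -> exists! w : Hom Q T, w ∘ q = u.

(* [i1] and [i2] are the morphisms <1,0> and <0,1>. *)
Definition commute {C : Category} {A B X : C} (f : Hom A X) (g : Hom B X) : Prop :=
  exists (P : C) (p1 : Hom P A) (p2 : Hom P B) (i1 : Hom A P) (i2 : Hom B P),
    is_product p1 p2 /\
    (p1 ∘ i1 = idm A /\ is_zero (p2 ∘ i1)) /\
    (is_zero (p1 ∘ i2) /\ p2 ∘ i2 = idm B) /\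
    exists phi : Hom P X, phi ∘ i1 = f /\ phi ∘ i2 = g.

(* A subobject is given by a representing monomorphism, so equality in the
   lattice of subobjects is [sub_eq], not Leibniz equality. *)
Record Sub {C : Category} (X : C) : Type := MkSub {
  sub_obj :> C;
  sub_mor : Hom sub_obj X;
  sub_mono : is_mono sub_mor
}.

Arguments sub_obj {C X} _.
Arguments sub_mor {C X} _.
Arguments sub_mono {C X} _.

Definition sub_le {C : Category} {X : C} (S T : Sub X) : Prop :=
  exists h : Hom (sub_obj S) (sub_obj T), sub_mor T ∘ h = sub_mor S.

Definition sub_eq {C : Category} {X : C} (S T : Sub X) : Prop :=
  sub_le S T /\ sub_le T S.

Lemma idm_mono {C : Category} (X : C) : is_mono (idm X).
Proof. intros T u v; now rewrite !comp_id_l. Qed.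

Definition sub_top {C : Category} (X : C) : Sub X := MkSub (@idm_mono C X).

Lemma comp_mono {C : Category} {X Y Z : C} (m : Hom Y Z) (n : Hom X Y) :
  is_mono m -> is_mono n -> is_mono (m ∘ n).
Proof.
intros Hm Hn T u v e; apply Hn, Hm; now rewrite !comp_assoc.
Qed.

Definition sub_comp {C : Category} {X : C} (S : Sub X) (T : Sub (sub_obj S)) : Sub X :=
  MkSub (comp_mono (sub_mono S) (sub_mono T)).

Definition sub_is_zero {C : Category} {X : C} (S : Sub X) : Prop :=
  is_zero_object (sub_obj S).

Definition normal_sub {C : Category} {X : C} (N : Sub X) : Prop :=
  exists (Y : C) (f : Hom X Y), is_kernel f (sub_mor N).

Definition is_join {C : Category} {X : C} (S T J : Sub X) : Prop :=
  sub_le S J /\ sub_le T J /\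
  forall U : Sub X, sub_le S U -> sub_le T U -> sub_le J U.

Definition commute_modulo {C : Category} {A B X : C}
    (f : Hom A X) (g : Hom B X) (N : Sub X) : Prop :=
  exists (Q : C) (q : Hom X Q),
    is_cokernel (sub_mor N) q /\ commute (q ∘ f) (q ∘ g).

Definition is_huq_commutator {C : Category} {A B X : C}
    (f : Hom A X) (g : Hom B X) (N : Sub X) : Prop :=
  normal_sub N /\ commute_modulo f g N /\
  forall M : Sub X, normal_sub M -> commute_modulo f g M -> sub_le N M.

(* A subobject satisfying [P]; it is used for universal properties, which
   determine the subobject up to [sub_eq].  The value is meaningful only when
   such a subobject exists, as joins and Huq commutators do in every
   semi-abelian category. *)
Definition the_sub {C : Category} {X : C} (P : Sub X -> Prop) : Sub X :=
  epsilon (inhabits (sub_top X)) P.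

Definition sub_join {C : Category} {X : C} (S T : Sub X) : Sub X :=
  the_sub (is_join S T).

Definition huq {C : Category} {X : C} (S T : Sub X) : Sub X :=
  the_sub (is_huq_commutator (sub_mor S) (sub_mor T)).

Declare Scope sub_scope.
Delimit Scope sub_scope with sub.
Notation "[ S , T ]" := (huq S T) : sub_scope.
Notation "S ∨ T" := (sub_join S T) (at level 50, left associativity) : sub_scope.
Notation "S ≤ T" := (sub_le S T) (at level 70, no associativity) : sub_scope.
Notation "S ≡ T" := (sub_eq S T) (at level 70, no associativity) : sub_scope.
Local Open Scope sub_scope.

Definition commutator_independent_of_ambient (C : Category) : Prop :=
  forall (X : C) (S : Sub X) (K L : Sub (sub_obj S)),
    normal_sub (sub_comp K) -> normal_sub (sub_comp L) ->
    sub_comp [K, L] ≡ [sub_comp K, sub_comp L].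

Definition commutator_preserves_joins (C : Category) : Prop :=
  forall (X : C) (K L M : Sub X),
    normal_sub K -> normal_sub L -> normal_sub M ->
    [K, L ∨ M] ≡ [K, L] ∨ [K, M].

Definition three_subobjects (C : Category) : Prop :=
  forall (X : C) (K L M : Sub X),
    normal_sub K -> normal_sub L -> normal_sub M ->
    [K, [L, M]] ≤ [[K, L], M] ∨ [L, [K, M]].

Definition gamma {C : Category} (X : C) (S : Sub X) : Sub X := [sub_top X, S].

Definition lower_central {C : Category} (X : C) (n : nat) : Sub X :=
  Nat.iter n (@gamma C X) (sub_top X).

Definition nilpotent {C : Category} (X : C) : Prop :=
  exists n : nat, sub_is_zero (lower_central X n).

Definition nilpotency_class {C : Category} (X : C) (n : nat) : Prop :=
  sub_is_zero (lower_central X n) /\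
  forall m : nat, sub_is_zero (lower_central X m) -> n <= m.

(* Main.v *)
Require Import Defs.
From Stdlib Require Import ssreflect ZArith Lia Classical ClassicalEpsilon.

(** The argument is Hall's. Put [N_1 = N] and [N_(i+1) = [N, N_i]], commutators
    being formed in [E]; since commutators of normal subobjects do not depend on
    the ambient object, this is also the lower central series of [N]. Distributivity
    over joins and the three subobjects lemma make [S |-> [E, S]] a derivation
    ([gamma_huq]). If [B] has class at most [d], then [[E, -]] applied [d] times to
    [E] ends in the kernel of [p], hence in [N_2]. A commutator of [i] copies of
    [N] to which [[E, -]] is applied [i(d-1) + 1] times contains one copy that
    has been hit [d] times, so it lies in [N_(i+1)]. Adding these numbers up for
    [i = 1, ..., c] gives the bound.

    The substance is in deriving the three conditions on commutators from algebraic
    coherence. All subobjects are handled through their generalized elements.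
    Protomodularity is used as an induction principle: the domain of a split
    epimorphism is generated by the kernel and the section ([split_epi_full]). It
    implies that reflexive relations are effective ([reflexive_effective]), so a
    normal subobject can be constructed as the class of zero of any reflexive
    relation. Algebraic coherence is used through [coherent_ker]: the kernel of a
    join of two points over [X] is generated by their kernels.

    The commutator of [f] and [g] is described as the indeterminacy of the relation
    from [A × B] to [X] generated by [f] and [g]; the Huq commutator is its normal
    closure. For normal [K] and [L], coherence identifies this relation with the fibre
    over [0] of a relation on [X], the [connector] of the two kernel pairs. From it
    one reads off that the commutator is already normal ([higgins_normal]), which gives
    independence of the ambient object. Distributivity over joins holds since coherence
    makes centralizers closed under joins ([commutes_join]). For the three subobjects
    lemma one divides the connector of [L] and [M] by diagonal copies of [[K, L]]
    and [[K, M]]; in the quotient [K] commutes with [L] and [M], hence with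
    [[L, M]], which embeds in it ([three_subobjects_commuting]). *)

Set Implicit Arguments.
Unset Strict Implicit.
Unset Printing Implicit Defensive.
Set Bullet Behavior "None".

Local Open Scope cat_scope.

(** * Generalized elements of subobjects *)

Definition mem {C : Category} {T X : C} (u : Hom T X) (S : Sub X) : Prop :=
  exists h : Hom T (sub_obj S), sub_mor S ∘ h = u.

Notation "u ∈ S" := (mem u S) (at level 70, no associativity).

(** The extremal epimorphisms; they coincide with the regular epimorphisms, but
    this form is the one that membership in a subobject can be tested along. *)
Definition covers {C : Category} {A X : C} (e : Hom A X) : Prop :=
  forall S : Sub X, e ∈ S -> idm X ∈ S.

Section Membership.
Context {C : Category}.

Lemma mem_comp (T U X : C) (u : Hom T X) (v : Hom U T) (S : Sub X) :
  u ∈ S -> u ∘ v ∈ S.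
Proof. by case=> h <-; exists (h ∘ v); rewrite comp_assoc. Qed.

Lemma mem_sub_mor (X : C) (S : Sub X) : sub_mor S ∈ S.
Proof. by exists (idm _); rewrite comp_id_r. Qed.

Lemma mem_sub_comp (X T : C) (S : Sub X) (h : Hom T (sub_obj S)) : sub_mor S ∘ h ∈ S.
Proof. by exists h. Qed.

Lemma mem_top (X T : C) (u : Hom T X) : u ∈ sub_top X.
Proof. by exists u; rewrite comp_id_l. Qed.

Lemma sub_leP (X : C) (S S' : Sub X) :
  sub_le S S' <-> forall (T : C) (u : Hom T X), u ∈ S -> u ∈ S'.
Proof.
split=> [[h e] T u [v <-]|H]; last by apply: H; apply: mem_sub_mor.
by exists (h ∘ v); rewrite comp_assoc e.
Qed.

Lemma sub_le_refl (X : C) (S : Sub X) : sub_le S S.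
Proof. by apply/sub_leP. Qed.

Lemma sub_le_trans (X : C) (R S S' : Sub X) : sub_le R S -> sub_le S S' -> sub_le R S'.
Proof. by move=> /sub_leP H /sub_leP H'; apply/sub_leP=> T u /H /H'. Qed.

Lemma sub_eq_sym (X : C) (S S' : Sub X) : sub_eq S S' -> sub_eq S' S.
Proof. by case. Qed.

Lemma sub_eq_trans (X : C) (R S S' : Sub X) : sub_eq R S -> sub_eq S S' -> sub_eq R S'.
Proof. by move=> [a b] [a' b']; split; apply: sub_le_trans; eauto. Qed.

Lemma sub_eqP (X : C) (S S' : Sub X) :
  sub_eq S S' <-> forall (T : C) (u : Hom T X), u ∈ S <-> u ∈ S'.
Proof.
split=> [[/sub_leP a /sub_leP b] T u|H]; first by split; [apply: a|apply: b].
by split; apply/sub_leP=> T u /H.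
Qed.

Lemma mem_subcompP (X : C) (S : Sub X) (S' : Sub (sub_obj S)) (T : C) (u : Hom T X) :
  u ∈ sub_comp S' <-> exists v : Hom T (sub_obj S), v ∈ S' /\ sub_mor S ∘ v = u.
Proof.
split=> [[h <-]|[v [[h <-] <-]]].
- by exists (sub_mor S' ∘ h); split; [exists h|rewrite comp_assoc].
- by exists h; rewrite comp_assoc.
Qed.

Lemma mem_subcomp_mor (X : C) (S : Sub X) (S' : Sub (sub_obj S)) (T : C)
    (v : Hom T (sub_obj S)) : sub_mor S ∘ v ∈ sub_comp S' <-> v ∈ S'.
Proof.
rewrite mem_subcompP; split=> [[w [Hw /sub_mono <-]]//|Hv]; by exists v.
Qed.

Lemma covers_comp (X Y Z : C) (e : Hom X Y) (e' : Hom Y Z) :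
  covers (e' ∘ e) -> covers e'.
Proof. by move=> H S HS; apply: H; apply: mem_comp. Qed.

Lemma regular_epi_covers (X Y : C) (e : Hom X Y) : is_regular_epi e -> covers e.
Proof.
case=> R [a [b [eab U]]] S [h eh].
have [|w [ew _]] := U _ h.
  by apply: (sub_mono S); rewrite !comp_assoc eh.
exists w; have [v [_ Uv]] := U _ e eab.
rewrite -(Uv (idm _)) ?comp_id_l //; symmetry; apply: Uv.
by rewrite -comp_assoc ew.
Qed.

Lemma regular_epi_cancel (X Y Z : C) (e : Hom X Y) (u v : Hom Y Z) :
  is_regular_epi e -> u ∘ e = v ∘ e -> u = v.
Proof.
case=> R [a [b [eab U]]] E.
have [|w [_ Uw]] := U _ (u ∘ e); first by rewrite -!comp_assoc eab.
by rewrite -(Uw u) // -(Uw v).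
Qed.

End Membership.

Section SemiAbelian.
Context {C : Category} (hC : semi_abelian C).

Local Notation cid := constructive_indefinite_description.

(** * Zero morphisms and products *)

Definition zero_obj : C := proj1_sig (cid _ (sa_pointed hC)).

Lemma zero_obj_zero : is_zero_object zero_obj.
Proof. exact: proj2_sig (cid _ (sa_pointed hC)). Qed.

Definition zero (X Y : C) : Hom X Y :=
  proj1_sig (cid _ (proj1 zero_obj_zero Y)) ∘ proj1_sig (cid _ (proj2 zero_obj_zero X)).

Local Notation "𝟘" := (zero _ _).

Lemma terminal_eq (Z X : C) (u v : Hom X Z) : is_terminal Z -> u = v.
Proof. by move/(_ X)=> [w [_ U]]; rewrite -(U u) // (U v). Qed.

Lemma initial_eq (Z X : C) (u v : Hom Z X) : is_initial Z -> u = v.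
Proof. by move/(_ X)=> [w [_ U]]; rewrite -(U u) // (U v). Qed.

Lemma zero_comp_l (X Y Z : C) (f : Hom X Y) : zero Y Z ∘ f = 𝟘.
Proof.
rewrite /zero -comp_assoc; congr (_ ∘ _).
exact: terminal_eq (proj2 zero_obj_zero).
Qed.

Lemma zero_comp_r (X Y Z : C) (f : Hom Y Z) : f ∘ zero X Y = 𝟘.
Proof.
rewrite /zero comp_assoc; congr (_ ∘ _).
exact: initial_eq (proj1 zero_obj_zero).
Qed.

Lemma is_zeroP (X Y : C) (f : Hom X Y) : is_zero f <-> f = 𝟘.
Proof.
split=> [[Z [a [b [[hi ht] ->]]]]|->].
- rewrite (terminal_eq a 𝟘 ht); exact: zero_comp_r.
- by do 3 eexists; split; first exact: zero_obj_zero.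
Qed.

Lemma is_zero_objectP (X : C) : is_zero_object X <-> idm X = 𝟘.
Proof.
split=> [[_ ht]|e]; first exact: terminal_eq ht.
split=> T; exists 𝟘; split=> // f _.
- by rewrite -(comp_id_r f) e zero_comp_r.
- by rewrite -(comp_id_l f) e zero_comp_l.
Qed.

Definition fl : has_finite_limits C := ex_finite_limits (sa_exact hC).

Definition prod_pb (A B : C) : Pullback (zero A zero_obj) (zero B zero_obj) :=
  pullback_of fl _ _.

Definition prod (A B : C) : C := pb_obj (prod_pb A B).

Local Notation "A × B" := (prod A B) (at level 40, left associativity).

Definition fst {A B : C} : Hom (A × B) A := pb_fst (prod_pb A B).
Definition snd {A B : C} : Hom (A × B) B := pb_snd (prod_pb A B).

Definition pair {T A B : C} (u : Hom T A) (v : Hom T B) : Hom T (A × B) :=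
  pb_pair (prod_pb A B) (terminal_eq (zero A zero_obj ∘ u) (zero B zero_obj ∘ v) (proj2 zero_obj_zero)).

Local Notation "⟨ u , v ⟩" := (pair u v) (format "⟨ u ,  v ⟩").

Lemma fst_pair (T A B : C) (u : Hom T A) (v : Hom T B) : fst ∘ ⟨u, v⟩ = u.
Proof. exact: pb_pair_fst. Qed.

Lemma snd_pair (T A B : C) (u : Hom T A) (v : Hom T B) : snd ∘ ⟨u, v⟩ = v.
Proof. exact: pb_pair_snd. Qed.

Lemma prod_ext (T A B : C) (u v : Hom T (A × B)) :
  fst ∘ u = fst ∘ v -> snd ∘ u = snd ∘ v -> u = v.
Proof. exact: pb_ext. Qed.

Lemma pair_comp (U T A B : C) (u : Hom T A) (v : Hom T B) (w : Hom U T) :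
  ⟨u, v⟩ ∘ w = ⟨u ∘ w, v ∘ w⟩.
Proof. by apply: prod_ext; rewrite comp_assoc ?fst_pair ?snd_pair. Qed.

Lemma pair_eta (T A B : C) (u : Hom T (A × B)) : u = ⟨fst ∘ u, snd ∘ u⟩.
Proof. by apply: prod_ext; rewrite ?fst_pair ?snd_pair. Qed.

Lemma pair_zero (T A B : C) : ⟨zero T A, zero T B⟩ = 𝟘.
Proof. by apply: prod_ext; rewrite ?fst_pair ?snd_pair zero_comp_r. Qed.

Lemma pair_inj (T A B : C) (u u' : Hom T A) (v v' : Hom T B) :
  ⟨u, v⟩ = ⟨u', v'⟩ -> u = u' /\ v = v'.
Proof. by move=> e; rewrite -(fst_pair u v) -{2}(snd_pair u v) e fst_pair snd_pair. Qed.

Lemma prod_is_product (A B : C) : is_product (@fst A B) (@snd A B).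
Proof.
move=> T u v; exists ⟨u, v⟩; split; first by rewrite fst_pair snd_pair.
by move=> w [<- <-]; rewrite -pair_eta.
Qed.

Hint Rewrite <- @comp_assoc : cat.
Hint Rewrite pair_comp fst_pair snd_pair zero_comp_l zero_comp_r pair_zero
  @comp_id_l @comp_id_r : cat.

Ltac nf := autorewrite with cat.

(** * Subobjects by comprehension *)

Lemma preimage_mono (X Y : C) (f : Hom X Y) (S : Sub Y) :
  is_mono (pb_fst (pullback_of fl f (sub_mor S))).
Proof.
move=> T u v e; apply: pb_ext => //; apply: (sub_mono S).
rewrite !comp_assoc -(proj1 (pb_is_pullback (pullback_of fl f (sub_mor S)))).
by rewrite -!comp_assoc e.
Qed.

Definition preimage {X Y : C} (f : Hom X Y) (S : Sub Y) : Sub X :=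
  MkSub (@preimage_mono X Y f S).

Lemma mem_preimage (T X Y : C) (f : Hom X Y) (S : Sub Y) (u : Hom T X) :
  u ∈ preimage f S <-> f ∘ u ∈ S.
Proof.
split=> [[h <-]|[h e]] /=.
- rewrite comp_assoc (proj1 (pb_is_pullback (pullback_of fl f (sub_mor S)))) -comp_assoc.
  by eexists.
- by exists (pb_pair (pullback_of fl f (sub_mor S)) (eq_sym e)) => /=; rewrite pb_pair_fst.
Qed.

Lemma diagonal_mono (X : C) : is_mono ⟨idm X, idm X⟩.
Proof. by move=> T u v; nf => /pair_inj[]. Qed.

Definition equalizer {X Y : C} (f g : Hom X Y) : Sub X :=
  preimage ⟨f, g⟩ (MkSub (@diagonal_mono Y)).

Lemma mem_equalizer (T X Y : C) (f g : Hom X Y) (u : Hom T X) :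
  u ∈ equalizer f g <-> f ∘ u = g ∘ u.
Proof.
rewrite mem_preimage; nf; split=> [[h] /=|->]; nf; first by case/pair_inj=> -> ->.
by exists (g ∘ u) => /=; nf.
Qed.

Definition meet {X : C} (S S' : Sub X) : Sub X := sub_comp (preimage (sub_mor S) S').

Lemma mem_meet (T X : C) (S S' : Sub X) (u : Hom T X) : u ∈ meet S S' <-> u ∈ S /\ u ∈ S'.
Proof.
rewrite mem_subcompP; split=> [[v [/mem_preimage H <-]]|[[h <-] H]].
- by split=> //; exists v.
- by exists h; rewrite mem_preimage.
Qed.

Definition ker {X Y : C} (f : Hom X Y) : Sub X := equalizer f 𝟘.

Lemma mem_ker (T X Y : C) (f : Hom X Y) (u : Hom T X) : u ∈ ker f <-> f ∘ u = 𝟘.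
Proof. by rewrite mem_equalizer zero_comp_l. Qed.

Lemma ker_mor (X Y : C) (f : Hom X Y) : f ∘ sub_mor (ker f) = 𝟘.
Proof. by apply/mem_ker; apply: mem_sub_mor. Qed.

Lemma is_kernelP (X Y : C) (f : Hom X Y) (N : Sub X) :
  is_kernel f (sub_mor N) <-> forall (T : C) (u : Hom T X), u ∈ N <-> f ∘ u = 𝟘.
Proof.
split=> [[/is_zeroP e U] T u|H].
- split=> [[h <-]|/is_zeroP /U [w [ew _]]]; last by exists w.
  by rewrite comp_assoc e zero_comp_l.
- split; first by apply/is_zeroP/H/mem_sub_mor.
  move=> T u /is_zeroP /H [h e]; exists h; split=> // h' e'.
  by apply: (sub_mono N); rewrite e.
Qed.

Lemma normal_subP (X : C) (N : Sub X) : normal_sub N <->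
  exists (Y : C) (f : Hom X Y), forall (T : C) (u : Hom T X), u ∈ N <-> f ∘ u = 𝟘.
Proof. by split=> [[Y [f /is_kernelP H]]|[Y [f H]]]; exists Y, f => //; apply/is_kernelP. Qed.

Lemma normal_ker (X Y : C) (f : Hom X Y) : normal_sub (ker f).
Proof. by apply/normal_subP; exists Y, f => T u; rewrite mem_ker. Qed.

Lemma normal_eq (X : C) (N N' : Sub X) : sub_eq N N' -> normal_sub N -> normal_sub N'.
Proof.
move=> /sub_eqP e /normal_subP [Y [f H]]; apply/normal_subP; exists Y, f => T u.
by rewrite -e.
Qed.

Lemma normal_preimage (X Y : C) (f : Hom X Y) (N : Sub Y) :
  normal_sub N -> normal_sub (preimage f N).
Proof.
move=> /normal_subP [Z [g H]]; apply/normal_subP; exists Z, (g ∘ f) => T u.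
by rewrite mem_preimage H comp_assoc.
Qed.

(** * Covers and images *)

Lemma covers_mem (T U X : C) (e : Hom U T) (u : Hom T X) (S : Sub X) :
  covers e -> u ∘ e ∈ S -> u ∈ S.
Proof.
move=> He H; rewrite -(comp_id_r u) -mem_preimage; apply: He.
by rewrite mem_preimage.
Qed.

Lemma covers_cancel (X Y Z : C) (e : Hom X Y) (u v : Hom Y Z) :
  covers e -> u ∘ e = v ∘ e -> u = v.
Proof.
move=> He E; rewrite -(comp_id_r u) -(comp_id_r v) -mem_equalizer.
by apply: He; rewrite mem_equalizer.
Qed.

Lemma pullback_regular_epi (A B Z : C) (u : Hom A Z) (e : Hom B Z) :
  is_regular_epi e -> exists (P : C) (e' : Hom P A) (v : Hom P B),
    is_regular_epi e' /\ u ∘ e' = e ∘ v.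
Proof.
move=> He; set P := pullback_of fl u e.
exists _, (pb_fst P), (pb_snd P); split; last exact: (proj1 (pb_is_pullback P)).
exact: (ex_stable (sa_exact hC) (pb_is_pullback P)).
Qed.

(** The image is the coequalizer of the kernel pair. The comparison is monic
    because two elements of the coequalizer lift, after a cover, to the
    domain of [f], where equality under [f] is membership in the kernel pair. *)
Lemma image_exists (A X : C) (f : Hom A X) :
  exists (S : Sub X) (e : Hom A (sub_obj S)), is_regular_epi e /\ sub_mor S ∘ e = f.
Proof.
set P := pullback_of fl f f.
have [eP UP] := pb_is_pullback P.
have [Q [q Hq]] := ex_coequalizers (sa_exact hC) (conj eP UP).
have rq : is_regular_epi q by do 3 eexists; exact: Hq.
have [eq Uq] := Hq; have [m [em _]] := Uq _ f eP.
have mm : is_mono m.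
  move=> T u v E.
  have [T1 [e1 [a [r1 E1]]]] := pullback_regular_epi u rq.
  have [T2 [e2 [b [r2 E2]]]] := pullback_regular_epi (v ∘ e1) rq.
  apply: (regular_epi_cancel r1); apply: (regular_epi_cancel r2).
  have [|w [[w1 w2] _]] := UP _ (a ∘ e2) b.
    rewrite -em -!comp_assoc -E2 (comp_assoc q) -E1.
    by rewrite !comp_assoc E.
  by rewrite E1 E2 -comp_assoc -w1 -w2 !comp_assoc eq.
by exists (MkSub mm), q.
Qed.

Lemma covers_regular_epi (X Y : C) (e : Hom X Y) : covers e -> is_regular_epi e.
Proof.
move=> He; have [S [q [[R [a [b [eab U]]]] E]]] := image_exists e.
have [|i Hi] := He S; first by exists q.
exists R, a, b; split; first by rewrite -E -!comp_assoc eab.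
move=> T u Eu; have [w [Ew Uw]] := U _ u Eu.
have Hi' : i ∘ sub_mor S = idm _.
  by apply: (sub_mono S); rewrite comp_assoc Hi comp_id_l comp_id_r.
exists (w ∘ i); split=> [|w' E'].
- by rewrite -E -comp_assoc (comp_assoc i) Hi' comp_id_l.
- by rewrite (Uw (w' ∘ sub_mor S)) -?comp_assoc ?E // Hi comp_id_r.
Qed.

Lemma pullback_covers (A B Z : C) (u : Hom A Z) (e : Hom B Z) :
  covers e -> exists (P : C) (e' : Hom P A) (v : Hom P B), covers e' /\ u ∘ e' = e ∘ v.
Proof.
move=> /covers_regular_epi /(pullback_regular_epi u) [P [e' [v [H E]]]].
by exists P, e', v; split=> //; apply: regular_epi_covers.
Qed.

Lemma covers_split (X Y : C) (e : Hom X Y) (s : Hom Y X) : e ∘ s = idm Y -> covers e.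
Proof. by move=> E S H; rewrite -E; apply: mem_comp. Qed.

Definition image {A X : C} (f : Hom A X) : Sub X :=
  proj1_sig (cid _ (image_exists f)).

Lemma imageP (A X : C) (f : Hom A X) :
  exists e : Hom A (sub_obj (image f)), covers e /\ sub_mor (image f) ∘ e = f.
Proof.
rewrite /image; case: (cid _ _) => S [e [He E]] /=.
by exists e; split=> //; apply: regular_epi_covers.
Qed.

Lemma mem_image (A X : C) (f : Hom A X) : f ∈ image f.
Proof. by have [e [_ E]] := imageP f; exists e. Qed.

(** Membership in an image is existence of a preimage on some cover: this is
    what replaces choosing an element of the domain. *)
Lemma mem_imageP (A X T : C) (f : Hom A X) (u : Hom T X) : u ∈ image f <->
  exists (U : C) (e : Hom U T) (v : Hom U A), covers e /\ u ∘ e = f ∘ v.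
Proof.
split=> [[h <-]|[U [e [v [He E]]]]].
- have [e [He E]] := imageP f.
  have [P [e' [v [He' E']]]] := pullback_covers h He.
  by exists P, e', v; rewrite -comp_assoc E' comp_assoc E.
- by apply: (covers_mem He); rewrite E; apply: mem_comp; apply: mem_image.
Qed.

Lemma image_le (A X : C) (f : Hom A X) (S : Sub X) : f ∈ S -> sub_le (image f) S.
Proof.
move=> H; apply/sub_leP=> T u /mem_imageP [U [e [v [He E]]]].
by apply: (covers_mem He); rewrite E; apply: mem_comp.
Qed.

(** In terms of the coproduct, the image of the copairing. *)
Lemma join_exists (A B X : C) (f : Hom A X) (g : Hom B X) :
  exists J : Sub X, f ∈ J /\ g ∈ J /\ forall S : Sub X, f ∈ S -> g ∈ S -> sub_le J S.
Proof.
have [P [i [j U]]] := has_binary_coproducts (sa_coproducts hC) A B.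
have [h [[hi hj] _]] := U _ f g.
exists (image h); split; first by rewrite -hi; apply: mem_comp; apply: mem_image.
split; first by rewrite -hj; apply: mem_comp; apply: mem_image.
move=> S [a Ha] [b Hb]; apply: image_le.
have [w [[wi wj] _]] := U _ a b; exists w.
have [v [_ Uv]] := U _ f g.
by rewrite -(Uv h) // -(Uv (sub_mor S ∘ w)) // -!comp_assoc wi wj.
Qed.

Definition join {A B X : C} (f : Hom A X) (g : Hom B X) : Sub X :=
  proj1_sig (cid _ (join_exists f g)).

Lemma join_l (A B X : C) (f : Hom A X) (g : Hom B X) : f ∈ join f g.
Proof. by rewrite /join; case: (cid _ _) => S [? []]. Qed.

Lemma join_r (A B X : C) (f : Hom A X) (g : Hom B X) : g ∈ join f g.
Proof. by rewrite /join; case: (cid _ _) => S [? [? ?]]. Qed.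

Lemma mem_join (A B X T : C) (f : Hom A X) (g : Hom B X) (S : Sub X) (u : Hom T X) :
  f ∈ S -> g ∈ S -> u ∈ join f g -> u ∈ S.
Proof.
rewrite /join; case: (cid _ _) => J [_ [_ H]] /= a b; move: T u.
by apply/sub_leP/H.
Qed.

(** * Protomodularity *)

(** Protomodularity in the form used throughout: the kernel and the section
    of a split epimorphism generate its domain. The subobject [S] is a point
    over [X], and base change along [0 -> X] turns its inclusion into an
    isomorphism of kernels; base change reflects isomorphisms. *)
Lemma split_epi_full (X A : C) (p : Hom A X) (s : Hom X A) (S : Sub A) :
  p ∘ s = idm X -> s ∈ S ->
  (forall (T : C) (u : Hom T A), p ∘ u = 𝟘 -> u ∈ S) -> idm A ∈ S.
Proof.
move=> E [s' Es] H; set m := sub_mor S.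
have E' : (p ∘ m) ∘ s' = idm X by rewrite -comp_assoc Es.
pose P0 := MkPoint E; pose P1 := MkPoint E'.
pose h := @MkPointHom C X P1 P0 m eq_refl Es.
suff [g [_ /(f_equal (@ph_mor _ _ _ _)) /= Hg]] : is_iso (h : @Hom (Pt X) P1 P0).
  by exists (ph_mor g).
have PM := @sa_protomodular C hC; rewrite /protomodular /reflects_isos in PM.
apply: (PM _ _ (zero zero_obj X)).
pose Q0 := pullback_of fl (zero zero_obj X) (pt_proj P0).
pose Q1 := pullback_of fl (zero zero_obj X) (pt_proj P1).
have Z0 := proj1 (pb_is_pullback Q0).
have [|k Hk] := H _ (pb_snd Q0); first by rewrite -[p ∘ _]Z0 zero_comp_l.
have c : zero zero_obj X ∘ pb_fst Q0 = pt_proj P1 ∘ k.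
  by rewrite Z0 /= -comp_assoc Hk.
have Hsec : pb_pair Q1 c ∘ pt_sec (base_obj fl (zero zero_obj X) P0) =
            pt_sec (base_obj fl (zero zero_obj X) P1).
  apply: (pb_ext (P := Q1)); rewrite comp_assoc.
  - by rewrite !pb_pair_fst.
  - rewrite !pb_pair_snd; apply: (sub_mono S).
    by rewrite comp_assoc Hk pb_pair_snd [in RHS]comp_assoc /= Es.
exists (@MkPointHom C zero_obj (base_obj fl _ P0) (base_obj fl _ P1)
          (pb_pair Q1 c) (pb_pair_fst Q1 c) Hsec).
split; apply: point_hom_ext => /=.
- apply: (pb_ext (P := Q1)); rewrite comp_assoc ?pb_pair_fst ?pb_pair_snd comp_id_r //.
  apply: (sub_mono S); rewrite comp_assoc Hk.
  exact: pb_pair_snd.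
- apply: (pb_ext (P := Q0)); rewrite comp_assoc ?pb_pair_fst ?pb_pair_snd comp_id_r //.
  by rewrite -comp_assoc pb_pair_snd.
Qed.

(** The previous principle for a point given inside an ambient object [Z],
    so that it can be used on relations without naming their carriers. *)
Lemma split_relation_ind (Z X : C) (R S : Sub Z) (p : Hom Z X) (s : Hom X Z) :
  p ∘ s = idm X -> s ∈ R -> s ∈ S ->
  (forall (T : C) (u : Hom T Z), u ∈ R -> p ∘ u = 𝟘 -> u ∈ S) ->
  sub_le R S.
Proof.
move=> E [s' Es] Hs H.
have [h Hh] : idm _ ∈ preimage (sub_mor R) S.
  apply: (@split_epi_full X _ (p ∘ sub_mor R) s').
  - by rewrite -comp_assoc Es.
  - by rewrite mem_preimage Es.
  - move=> T u; rewrite -comp_assoc mem_preimage; apply: H; exact: mem_sub_comp.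
apply/sub_leP=> T u [v <-].
by rewrite -mem_preimage -(comp_id_l v) -Hh -comp_assoc; apply: mem_sub_comp.
Qed.

(** A kernel pair is split by its diagonal, and the kernel of its first
    projection is [{(0, u) | f u = 0}]. *)
Lemma kernel_pair_ind (X Y : C) (f : Hom X Y) (S : Sub (X × X)) :
  ⟨idm X, idm X⟩ ∈ S ->
  (forall (T : C) (u : Hom T X), f ∘ u = 𝟘 -> ⟨zero T X, u⟩ ∈ S) ->
  forall (T : C) (u v : Hom T X), f ∘ u = f ∘ v -> ⟨u, v⟩ ∈ S.
Proof.
move=> Hs H T u v E.
have /sub_leP le : sub_le (equalizer (f ∘ fst) (f ∘ snd)) S.
  apply: (@split_relation_ind _ _ _ _ fst ⟨idm X, idm X⟩) => //.
  - by nf.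
  - by rewrite mem_equalizer; nf.
  - move=> U w; rewrite mem_equalizer (pair_eta w); nf=> e e0.
    by rewrite e0; apply: H; rewrite -e e0 zero_comp_r.
by apply: le; rewrite mem_equalizer; nf.
Qed.

Lemma mono_of_trivial_ker (X Y : C) (f : Hom X Y) :
  (forall (T : C) (u : Hom T X), f ∘ u = 𝟘 -> u = 𝟘) ->
  is_mono f.
Proof.
move=> H T u v E.
have : ⟨u, v⟩ ∈ equalizer fst snd.
  apply: (kernel_pair_ind (f := f)) E; first by rewrite mem_equalizer; nf.
  by move=> U w /H ->; rewrite mem_equalizer; nf.
by rewrite mem_equalizer; nf.
Qed.

Lemma ker_le_eq (X Y Z : C) (f : Hom X Y) (g : Hom X Z) :
  (forall (T : C) (u : Hom T X), f ∘ u = 𝟘 -> g ∘ u = 𝟘) ->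
  forall (T : C) (u v : Hom T X), f ∘ u = f ∘ v -> g ∘ u = g ∘ v.
Proof.
move=> H T u v E.
have : ⟨u, v⟩ ∈ equalizer (g ∘ fst) (g ∘ snd).
  apply: (kernel_pair_ind (f := f)) E; first by rewrite mem_equalizer; nf.
  by move=> U w /H e; rewrite mem_equalizer; nf.
by rewrite mem_equalizer; nf.
Qed.

(** Every regular epimorphism is the cokernel of its kernel. *)
Lemma covers_factor (X Y Z : C) (f : Hom X Y) (g : Hom X Z) :
  covers f -> (forall (T : C) (u : Hom T X), f ∘ u = 𝟘 -> g ∘ u = 𝟘) ->
  exists h : Hom Y Z, h ∘ f = g.
Proof.
move=> /covers_regular_epi [R [a [b [E U]]]] /ker_le_eq H.
by have [h [Hh _]] := U _ g (H _ _ _ E); exists h.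
Qed.

(** A subobject containing a kernel is a union of fibres: the pairs [(y, z)]
    with [y] in [S] and [b y = b z] form a point over [S] whose kernel
    consists of elements [(0, z)] with [b z = 0]. *)
Lemma ker_saturated (X Y T : C) (b : Hom X Y) (S : Sub X) (y z : Hom T X) :
  (forall (U : C) (u : Hom U X), b ∘ u = 𝟘 -> u ∈ S) ->
  y ∈ S -> b ∘ y = b ∘ z -> z ∈ S.
Proof.
move=> H [h <-] E.
have /sub_leP le : sub_le (equalizer (b ∘ (sub_mor S ∘ fst)) (b ∘ snd)) (preimage snd S).
  apply: (@split_relation_ind _ _ _ _ fst ⟨idm S, sub_mor S⟩).
  - by nf.
  - by rewrite mem_equalizer; nf.
  - by rewrite mem_preimage; nf; apply: mem_sub_mor.
  - move=> U w; rewrite mem_equalizer mem_preimage => e e0; apply: H.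
    by move: e; nf; rewrite e0; nf.
have : ⟨h, z⟩ ∈ preimage snd S by apply: le; rewrite mem_equalizer; nf.
by rewrite mem_preimage; nf.
Qed.

Lemma short_five (X Y : C) (f : Hom X Y) (S : Sub X) :
  (forall (U : C) (u : Hom U X), f ∘ u = 𝟘 -> u ∈ S) ->
  covers (f ∘ sub_mor S) -> idm X ∈ S.
Proof.
move=> H He; have [P [e [v [He' E]]]] := pullback_covers f He.
apply: (covers_mem He'); rewrite comp_id_l.
apply: (ker_saturated H (y := sub_mor S ∘ v)); first exact: mem_sub_comp.
by rewrite E comp_assoc.
Qed.

(** * Equivalence relations, cokernels and normal subobjects *)

(** The Mal'tsev property. The quadruples [(a, b, c, d)] form a point over
    the triples [(a, b, c)], with section [d := b]; on the section the
    conclusion is the first hypothesis, and on the kernel, where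
    [a = b = c = 0], it is the third. *)
Lemma difunctional (X T : C) (R : Sub (X × X)) (a b c d : Hom T X) :
  ⟨a, b⟩ ∈ R -> ⟨c, b⟩ ∈ R -> ⟨c, d⟩ ∈ R -> ⟨a, d⟩ ∈ R.
Proof.
move=> ab cb cd.
pose pa : Hom (X × X × X) X := fst ∘ fst.
pose pb : Hom (X × X × X) X := snd ∘ fst.
pose G := meet (preimage ⟨pa, pb⟩ R) (preimage ⟨snd, pb⟩ R).
have HG (U : C) (x y z : Hom U X) : ⟨⟨x, y⟩, z⟩ ∈ G <-> ⟨x, y⟩ ∈ R /\ ⟨z, y⟩ ∈ R.
  by rewrite mem_meet !mem_preimage /pa /pb; nf.
have /sub_leP le : sub_le (preimage ⟨snd ∘ (sub_mor G ∘ fst), snd⟩ R)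
                          (preimage ⟨pa ∘ (sub_mor G ∘ fst), snd⟩ R).
  have Gm := mem_sub_mor G; rewrite (pair_eta (sub_mor G)) (pair_eta (fst ∘ sub_mor G)) in Gm.
  move/HG: Gm => [Gab Gcb].
  apply: (@split_relation_ind _ _ _ _ fst ⟨idm G, pb ∘ sub_mor G⟩).
  - by nf.
  - by rewrite mem_preimage /pa /pb; nf.
  - by rewrite mem_preimage /pa /pb; nf.
  - by move=> U w; rewrite !mem_preimage; nf=> H e0; move: H; rewrite e0; nf.
have [|h Hh] := proj2 (HG _ a b c); first by split.
have : ⟨h, d⟩ ∈ preimage ⟨pa ∘ (sub_mor G ∘ fst), snd⟩ R.
  by apply: le; rewrite mem_preimage; nf; rewrite Hh; nf.
by rewrite mem_preimage /pa; nf; rewrite Hh; nf.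
Qed.

(** A reflexive difunctional relation is symmetric and transitive, hence a
    kernel pair by exactness. This is the way normal subobjects are produced
    below: as the class of zero of a reflexive relation. *)
Lemma reflexive_effective (X : C) (R : Sub (X × X)) : ⟨idm X, idm X⟩ ∈ R ->
  exists (Y : C) (f : Hom X Y), forall (T : C) (u v : Hom T X),
    ⟨u, v⟩ ∈ R <-> f ∘ u = f ∘ v.
Proof.
move=> Rd.
have Rr (T : C) (u : Hom T X) : ⟨u, u⟩ ∈ R.
  by have := mem_comp u Rd; nf.
have Rs (T : C) (u v : Hom T X) : ⟨u, v⟩ ∈ R -> ⟨v, u⟩ ∈ R.
  by move=> H; apply: (difunctional (b := v) (c := u)).
have Rt (T : C) (u v w : Hom T X) : ⟨u, v⟩ ∈ R -> ⟨v, w⟩ ∈ R -> ⟨u, w⟩ ∈ R.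
  by move=> H H'; apply: (difunctional (b := v) (c := v)).
pose r1 := fst ∘ sub_mor R; pose r2 := snd ∘ sub_mor R.
have Rm (T : C) (h : Hom T R) : ⟨r1 ∘ h, r2 ∘ h⟩ = sub_mor R ∘ h.
  by rewrite (pair_eta (_ ∘ h)) /r1 /r2; nf.
have eqR : is_equivalence_relation r1 r2.
  split.
  - by move=> T u v e1 e2; apply: (sub_mono R); rewrite -!Rm e1 e2.
  - by case: Rd=> d e; exists d; rewrite /r1 /r2; nf; rewrite e; nf.
  - have [|s e] := Rs _ r1 r2.
      by have := Rm _ (idm R); nf=> ->; apply: mem_sub_mor.
    by exists s; rewrite /r1 /r2; nf; rewrite e; nf.
  - move=> P p1 p2 [E _].
    have [||t e] := Rt _ (r1 ∘ p1) (r2 ∘ p1) (r2 ∘ p2).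
    + by rewrite Rm; apply: mem_sub_comp.
    + by rewrite E Rm; apply: mem_sub_comp.
    by exists t; apply: pair_inj; rewrite Rm.
have [Y [f [E U]]] := ex_effective (sa_exact hC) eqR.
exists Y, f => T u v; split=> [[h Hh]|/U [h [[<- <-] _]]]; last first.
  by rewrite Rm; apply: mem_sub_comp.
move: Hh; rewrite -Rm => /pair_inj[<- <-].
by rewrite (comp_assoc f r1) (comp_assoc f r2) E.
Qed.

(** The reflexive relation generated by the pairs [(0, f a)] is a kernel
    pair; its coequalizer kills [f] universally. *)
Lemma cokernel_exists (A X : C) (f : Hom A X) :
  exists (Q : C) (q : Hom X Q), is_cokernel f q /\ covers q.
Proof.
pose R := join ⟨idm X, idm X⟩ ⟨zero A X, f⟩.
have [Y [h Hh]] := reflexive_effective (join_l ⟨idm X, idm X⟩ ⟨zero A X, f⟩ : _ ∈ R).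
have hf : h ∘ f = 𝟘.
  by rewrite -(proj1 (Hh _ _ _) (join_r ⟨idm X, idm X⟩ ⟨zero A X, f⟩)) zero_comp_r.
pose P := pullback_of fl h h.
have [Q [q Hq]] := ex_coequalizers (sa_exact hC) (pb_is_pullback P).
have cq : covers q by apply: regular_epi_covers; do 3 eexists; exact: Hq.
have [Eq Uq] := Hq.
exists Q, q; split=> //; split.
- apply/is_zeroP.
  have [|w [[w1 w2] _]] := proj2 (pb_is_pullback P) A f 𝟘.
    by rewrite hf zero_comp_r.
  by rewrite -w1 comp_assoc Eq -comp_assoc w2 zero_comp_r.
- move=> T u /is_zeroP uf; apply: Uq.
  have : ⟨pb_fst P, pb_snd P⟩ ∈ equalizer (u ∘ fst) (u ∘ snd).
    apply: (mem_join (f := ⟨idm X, idm X⟩) (g := ⟨zero A X, f⟩)).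
    + by rewrite mem_equalizer; nf.
    + by rewrite mem_equalizer; nf; rewrite uf.
    + by apply/Hh; apply: (proj1 (pb_is_pullback P)).
  by rewrite mem_equalizer; nf.
Qed.

(** The image of the equivalence relation of [N] is reflexive, hence
    effective, and its class of zero is the image of [N]: that no further
    elements appear in that class is where protomodularity enters. *)
Lemma image_normal (X Y : C) (f : Hom X Y) (N : Sub X) :
  covers f -> normal_sub N -> normal_sub (image (f ∘ sub_mor N)).
Proof.
move=> Hf /normal_subP [Q [g Hg]].
pose R := equalizer (g ∘ fst) (g ∘ snd) : Sub (X × X).
have RP (T : C) (u v : Hom T X) : ⟨u, v⟩ ∈ R <-> g ∘ u = g ∘ v.
  by rewrite mem_equalizer; nf.
pose r1 := fst ∘ sub_mor R; pose r2 := snd ∘ sub_mor R.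
have Rm (T : C) (h : Hom T R) : ⟨r1 ∘ h, r2 ∘ h⟩ = sub_mor R ∘ h.
  by rewrite (pair_eta (_ ∘ h)) /r1 /r2; nf.
have Rr (T : C) (h : Hom T R) : g ∘ (r1 ∘ h) = g ∘ (r2 ∘ h).
  by apply/RP; rewrite Rm; apply: mem_sub_comp.
have Rl (T : C) (u v : Hom T X) : g ∘ u = g ∘ v ->
    exists h : Hom T R, r1 ∘ h = u /\ r2 ∘ h = v.
  by move/RP=> [h]; rewrite -Rm => /pair_inj[<- <-]; exists h.
(* R' is the image of the equivalence relation of N; it is again effective. *)
pose R' := image ⟨f ∘ r1, f ∘ r2⟩.
have R'r : ⟨idm Y, idm Y⟩ ∈ R'.
  apply: (covers_mem Hf); nf; have [h [h1 h2]] := Rl _ (idm X) (idm X) eq_refl.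
  have := mem_comp h (mem_image ⟨f ∘ r1, f ∘ r2⟩); nf.
  by rewrite h1 h2; nf.
have [Z [k Hk]] := reflexive_effective R'r.
(* P is the pullback of R' along f; as R maps onto R' and P' contains the
   kernel {(u, 0) | f u = 0} of P -> R', the image P' of R is all of P. *)
pose P := preimage ⟨f ∘ fst, snd⟩ R' : Sub (X × Y).
pose P' := image ⟨r1, f ∘ r2⟩ : Sub (X × Y).
have P'P : ⟨r1, f ∘ r2⟩ ∈ P.
  by rewrite mem_preimage; nf; apply: mem_image.
have P'le := image_le P'P.
have PP' : sub_le P P'.
  have [R'h R'e] : ⟨f ∘ fst, snd⟩ ∘ sub_mor P ∈ R'.
    by rewrite -mem_preimage; apply: mem_sub_mor.
  suff [w Hw] : idm P ∈ preimage (sub_mor P) P'.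
    apply/sub_leP=> T u [v <-]; rewrite -mem_preimage -(comp_id_l v) -Hw -comp_assoc.
    exact: mem_sub_comp.
  apply: (short_five (f := R'h)).
  - move=> U u e; rewrite mem_preimage (pair_eta (sub_mor P ∘ u)).
    have /pair_inj[e1 e2] : ⟨f ∘ (fst ∘ (sub_mor P ∘ u)), snd ∘ (sub_mor P ∘ u)⟩ = ⟨𝟘, 𝟘⟩.
      have := f_equal (fun w => w ∘ u) R'e; rewrite -comp_assoc e zero_comp_r; nf=> <- //.
    rewrite e2 -e1.
    have [h [h1 h2]] := Rl _ (fst ∘ (sub_mor P ∘ u)) _ eq_refl.
    have := mem_comp h (mem_image ⟨r1, f ∘ r2⟩); nf.
    by rewrite h1 h2.
  - have [w Hw] := P'P.
    have [z Hz] : w ∈ preimage (sub_mor P) P'.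
      by rewrite mem_preimage Hw; apply: mem_image.
    apply: (@covers_comp _ _ _ _ z); rewrite -comp_assoc Hz.
    have [e [He Ee]] := imageP ⟨f ∘ r1, f ∘ r2⟩.
    suff -> : R'h ∘ w = e by [].
    apply: (sub_mono R'); rewrite comp_assoc R'e -comp_assoc Hw Ee.
    by nf.
apply/normal_subP; exists Z, k => T y; split.
- suff /image_le /sub_leP H : f ∘ sub_mor N ∈ ker k by move=> /H; rewrite mem_ker.
  rewrite mem_ker -(zero_comp_r N k); symmetry; apply/Hk.
  have [|h [h1 h2]] := Rl _ 𝟘 (sub_mor N).
    by rewrite zero_comp_r; symmetry; apply/Hg/mem_sub_mor.
  have := mem_comp h (mem_image ⟨f ∘ r1, f ∘ r2⟩); nf.
  by rewrite h1 h2; nf.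
- move=> Hy; have H : ⟨zero T Y, y⟩ ∈ R' by apply/Hk; rewrite zero_comp_r.
  have : ⟨𝟘, y⟩ ∈ P' by move/sub_leP: PP'; apply; rewrite mem_preimage; nf.
  move=> /mem_imageP [U [e [v [He]]]]; nf=> /pair_inj[e1 e2].
  apply: (covers_mem He); rewrite e2.
  have /Hg [w <-] : g ∘ (r2 ∘ v) = 𝟘 by rewrite -Rr -e1 zero_comp_r.
  by rewrite comp_assoc; apply: mem_comp; apply: mem_image.
Qed.

(** The composite of the two equivalence relations is reflexive, hence
    effective; the class of zero of the composite consists of the [z] that
    are congruent modulo [S'] to an element of [S]. *)
Lemma join_normal (X : C) (S S' : Sub X) :
  normal_sub S -> normal_sub S' -> normal_sub (join (sub_mor S) (sub_mor S')).
Proof.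
move=> /normal_subP [A [a Ha]] /normal_subP [B [b Hb]].
pose px : Hom (X × X × X) X := fst ∘ fst.
pose py : Hom (X × X × X) X := snd ∘ fst.
pose W := meet (equalizer (a ∘ px) (a ∘ py)) (equalizer (b ∘ py) (b ∘ snd)).
have HW (T : C) (x y z : Hom T X) :
    ⟨⟨x, y⟩, z⟩ ∈ W <-> a ∘ x = a ∘ y /\ b ∘ y = b ∘ z.
  by rewrite mem_meet !mem_equalizer /px /py; nf.
pose R := image (⟨px, snd⟩ ∘ sub_mor W).
have HR (T : C) (x y z : Hom T X) : a ∘ x = a ∘ y -> b ∘ y = b ∘ z -> ⟨x, z⟩ ∈ R.
  move=> e e'; have [h Hh] := proj2 (HW _ _ _ _) (conj e e').
  have := mem_comp h (mem_image (⟨px, snd⟩ ∘ sub_mor W)).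
  by rewrite -/R /px; nf; rewrite Hh; nf.
have [Y [k Hk]] := reflexive_effective (HR _ (idm X) (idm X) (idm X) eq_refl eq_refl).
apply/normal_subP; exists Y, k => T z; split=> [Hz|kz].
- rewrite -mem_ker; apply: mem_join Hz; rewrite mem_ker -(zero_comp_r _ k);
    symmetry; apply/Hk.
  + apply: (HR _ _ (sub_mor S)) => //.
    by rewrite zero_comp_r; symmetry; apply/Ha/mem_sub_mor.
  + apply: (HR _ _ 𝟘); rewrite ?zero_comp_r //.
    by symmetry; apply/Hb/mem_sub_mor.
- have : ⟨𝟘, z⟩ ∈ R by apply/Hk; rewrite zero_comp_r.
  move=> /mem_imageP [U [e [v [He]]]].
  have Wv := mem_sub_comp v.
  rewrite (pair_eta (_ ∘ v)) (pair_eta (fst ∘ _)) in Wv; move/HW: Wv => [Wa Wb].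
  rewrite /px; nf=> /pair_inj[e1 e2]; apply: (covers_mem He); rewrite e2.
  apply: (ker_saturated (b := b)) Wb => [U' u /Hb [w <-]|].
    by apply: mem_comp; apply: join_r.
  have /Ha [w <-] : a ∘ (snd ∘ (fst ∘ (sub_mor W ∘ v))) = 𝟘.
    by rewrite -Wa -e1 zero_comp_r.
  by apply: mem_comp; apply: join_l.
Qed.

Lemma joinP (X : C) (S S' : Sub X) : is_join S S' (join (sub_mor S) (sub_mor S')).
Proof.
have [l r] := conj (join_l (sub_mor S) (sub_mor S')) (join_r (sub_mor S) (sub_mor S')).
split; [|split]=> // U /sub_leP HS /sub_leP HS'; apply/sub_leP=> T u.
by apply: mem_join; [apply: HS|apply: HS']; apply: mem_sub_mor.
Qed.

Lemma sub_joinP (X : C) (S S' : Sub X) : is_join S S' (sub_join S S').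
Proof. by apply: epsilon_spec; eexists; apply: joinP. Qed.

Lemma sub_join_eq (X : C) (S S' : Sub X) :
  sub_eq (sub_join S S') (join (sub_mor S) (sub_mor S')).
Proof.
have [a [b c]] := sub_joinP S S'; have [a' [b' c']] := joinP S S'.
by split; [apply: c|apply: c'].
Qed.

Lemma sub_join_normal (X : C) (S S' : Sub X) :
  normal_sub S -> normal_sub S' -> normal_sub (sub_join S S').
Proof.
move=> H H'; apply: normal_eq (join_normal H H'); apply: sub_eq_sym.
exact: sub_join_eq.
Qed.

(** * Commuting morphisms and the Higgins commutator *)

(** Protomodular categories are unital. *)
Lemma product_ind (A B : C) (S : Sub (A × B)) :
  ⟨idm A, 𝟘⟩ ∈ S -> ⟨𝟘, idm B⟩ ∈ S -> idm (A × B) ∈ S.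
Proof.
move=> H1 H2; apply: (split_epi_full (p := fst) (s := ⟨idm A, 𝟘⟩)) => //; first by nf.
move=> T u e; rewrite (pair_eta u) e.
by have := mem_comp (snd ∘ u) H2; nf.
Qed.

(** The choice of product is fixed once and for all; [commuteP] says that it
    does not matter. *)
Definition commutes {A B X : C} (f : Hom A X) (g : Hom B X) : Prop :=
  exists φ : Hom (A × B) X, φ ∘ ⟨idm A, 𝟘⟩ = f /\ φ ∘ ⟨𝟘, idm B⟩ = g.

Lemma commuteP (A B X : C) (f : Hom A X) (g : Hom B X) : commute f g <-> commutes f g.
Proof.
split=> [[P [p1 [p2 [i1 [i2 [HP [[e11 /is_zeroP e12] [[/is_zeroP e21 e22] [φ [e1 e2]]]]]]]]]]
        |[φ [e1 e2]]]; last first.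
- exists (A × B), fst, snd, ⟨idm A, 𝟘⟩, ⟨𝟘, idm B⟩; split; first exact: prod_is_product.
  by rewrite !is_zeroP; nf; do !split => //; exists φ.
have [w [[w1 w2] _]] := HP _ (@fst A B) (@snd A B).
have uniq (T : C) (u v : Hom T P) : p1 ∘ u = p1 ∘ v -> p2 ∘ u = p2 ∘ v -> u = v.
  move=> E1 E2; have [x [_ Ux]] := HP _ (p1 ∘ u) (p2 ∘ u).
  by rewrite -(Ux u) // -(Ux v).
exists (φ ∘ w); rewrite -e1 -e2 -!comp_assoc; split; congr (_ ∘ _); apply: uniq;
  by rewrite comp_assoc ?w1 ?w2 ?e11 ?e12 ?e21 ?e22; nf.
Qed.

Lemma commutes_comp (A B X Y : C) (f : Hom A X) (g : Hom B X) (h : Hom X Y) :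
  commutes f g -> commutes (h ∘ f) (h ∘ g).
Proof. by move=> [φ [<- <-]]; exists (h ∘ φ); rewrite !comp_assoc. Qed.

Lemma commutes_precomp (A B A' B' X : C) (f : Hom A X) (g : Hom B X)
    (a : Hom A' A) (b : Hom B' B) : commutes f g -> commutes (f ∘ a) (g ∘ b).
Proof.
by move=> [φ [<- <-]]; exists (φ ∘ ⟨a ∘ fst, b ∘ snd⟩); nf.
Qed.

Lemma commutes_sym (A B X : C) (f : Hom A X) (g : Hom B X) : commutes f g -> commutes g f.
Proof. by move=> [φ [<- <-]]; exists (φ ∘ ⟨snd, fst⟩); nf. Qed.

Lemma commutes_zero (A B X : C) (f : Hom A X) : commutes f (zero B X).
Proof. by exists (f ∘ fst); nf. Qed.

(** The relation from [A × B] to [X] generated by [f] and [g]. It is the graph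
    of a morphism exactly when [f] and [g] commute. *)
Definition higgins_graph {A B X : C} (f : Hom A X) (g : Hom B X) : Sub (A × B × X) :=
  join ⟨⟨idm A, 𝟘⟩, f⟩ ⟨⟨𝟘, idm B⟩, g⟩.

(** The indeterminacy of the relation above. This is the image in [X] of
    the kernel of [A + B -> A × B], that is, the Higgins commutator; this
    description needs no coproduct and makes it evident that a monomorphism
    out of [X] changes nothing. *)
Definition higgins {A B X : C} (f : Hom A X) (g : Hom B X) : Sub X :=
  preimage ⟨𝟘, idm X⟩ (higgins_graph f g).

Lemma mem_higgins (A B X T : C) (f : Hom A X) (g : Hom B X) (u : Hom T X) :
  u ∈ higgins f g <-> ⟨𝟘, u⟩ ∈ higgins_graph f g.
Proof. by rewrite mem_preimage; nf. Qed.

(** The relation [higgins_graph f g] covers [A × B], and the kernel of that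
    cover is the Higgins commutator. A morphism killing it therefore turns
    the relation into a morphism defined on [A × B]. *)
Lemma commutes_iff (A B X Y : C) (f : Hom A X) (g : Hom B X) (h : Hom X Y) :
  commutes (h ∘ f) (h ∘ g) <-> sub_le (higgins f g) (ker h).
Proof.
split=> [[φ [e1 e2]]|/sub_leP H].
- apply/sub_leP=> T u; rewrite mem_higgins mem_ker => Hu.
  have : ⟨𝟘, u⟩ ∈ equalizer (φ ∘ fst) (h ∘ snd).
    by apply: mem_join Hu; rewrite mem_equalizer; nf.
  by rewrite mem_equalizer; nf.
- pose G := higgins_graph f g.
  have [w Hw] : ⟨⟨idm A, 𝟘⟩, f⟩ ∈ G by apply: join_l.
  have [w' Hw'] : ⟨⟨𝟘, idm B⟩, g⟩ ∈ G by apply: join_r.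
  have [||φ Hφ] := @covers_factor G (A × B) Y (fst ∘ sub_mor G) (h ∘ (snd ∘ sub_mor G)).
  + move=> S HS; apply: product_ind.
      by have := mem_comp w HS; nf; rewrite Hw; nf.
    by have := mem_comp w' HS; nf; rewrite Hw'; nf.
  + move=> T u e; nf; apply/mem_ker/H; rewrite mem_higgins.
    move: e; rewrite -comp_assoc => <-.
    by rewrite -pair_eta; apply: mem_sub_comp.
  exists φ; split.
  + by have := f_equal (fun x => x ∘ w) Hφ; nf; rewrite Hw; nf.
  + by have := f_equal (fun x => x ∘ w') Hφ; nf; rewrite Hw'; nf.
Qed.

Lemma commutes_covers (A A' B X : C) (e : Hom A A') (f : Hom A' X) (g : Hom B X) :
  covers e -> commutes (f ∘ e) g -> commutes f g.
Proof.
move=> He [φ [φ1 φ2]].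
have [||φ' Hφ] := @covers_factor _ _ _ ⟨e ∘ fst, snd⟩ φ.
- move=> S HS; apply: product_ind.
  + by apply: (covers_mem He); have := mem_comp ⟨idm A, zero A B⟩ HS; nf.
  + by have := mem_comp ⟨zero B A, idm B⟩ HS; nf.
- move=> T u; nf; rewrite -(pair_zero T A' B) => /pair_inj[e1 e2].
  rewrite (pair_eta u) e2.
  have -> : φ ∘ ⟨fst ∘ u, 𝟘⟩ = (φ ∘ ⟨idm A, 𝟘⟩) ∘ (fst ∘ u) by nf.
  by rewrite φ1 -comp_assoc e1 zero_comp_r.
exists φ'; split.
- apply: (covers_cancel He).
  by rewrite -φ1; have := f_equal (fun x => x ∘ ⟨idm A, 𝟘⟩) Hφ; nf.
- by rewrite -φ2; have := f_equal (fun x => x ∘ ⟨𝟘, idm B⟩) Hφ; nf.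
Qed.

Lemma commutes_images (A B X : C) (f : Hom A X) (g : Hom B X) :
  commutes f g -> commutes (sub_mor (image f)) (sub_mor (image g)).
Proof.
have [e [He Ee]] := imageP f; have [e' [He' Ee']] := imageP g.
move=> H; apply: (commutes_covers He); apply: commutes_sym.
by apply: (commutes_covers He'); apply: commutes_sym; rewrite Ee Ee'.
Qed.

(** * Huq commutators *)

Lemma ker_cokernel (X Q : C) (N : Sub X) (q : Hom X Q) :
  normal_sub N -> is_cokernel (sub_mor N) q ->
  forall (T : C) (u : Hom T X), u ∈ N <-> q ∘ u = 𝟘.
Proof.
move=> /normal_subP [Y [f Hf]] [/is_zeroP e U] T u; split=> [[h <-]|qu].
  by rewrite comp_assoc e zero_comp_l.
have [|f' [Ef _]] := U _ f; first by apply/is_zeroP/Hf/mem_sub_mor.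
by apply/Hf; rewrite -Ef -comp_assoc qu zero_comp_r.
Qed.

Lemma quotient_exists (X : C) (N : Sub X) : normal_sub N ->
  exists (Q : C) (q : Hom X Q), is_cokernel (sub_mor N) q /\ covers q /\
    forall (T : C) (u : Hom T X), u ∈ N <-> q ∘ u = 𝟘.
Proof.
move=> HN; have [Q [q [Hq cq]]] := cokernel_exists (sub_mor N).
by exists Q, q; split=> //; split=> //; apply: ker_cokernel.
Qed.

Lemma commute_modulo_iff (A B X : C) (f : Hom A X) (g : Hom B X) (N : Sub X) :
  normal_sub N -> (commute_modulo f g N <-> sub_le (higgins f g) N).
Proof.
move=> HN; split=> [[Q [q [Hq /commuteP /commutes_iff /sub_leP H]]]|/sub_leP H].
- by apply/sub_leP=> T u /H; rewrite mem_ker -(ker_cokernel HN Hq).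
- have [Q [q [Hq [_ E]]]] := quotient_exists HN; exists Q, q; split=> //.
  by apply/commuteP/commutes_iff/sub_leP=> T u /H /E; rewrite mem_ker.
Qed.

Lemma normal_closure_exists (X : C) (S : Sub X) :
  exists N : Sub X, normal_sub N /\ sub_le S N /\
    forall M : Sub X, normal_sub M -> sub_le S M -> sub_le N M.
Proof.
have [Q [q [[/is_zeroP e U] _]]] := cokernel_exists (sub_mor S).
exists (ker q); split; first exact: normal_ker.
split; first by apply/sub_leP=> T u [h <-]; rewrite mem_ker comp_assoc e zero_comp_l.
move=> M /normal_subP [Y [f Hf]] /sub_leP SM.
have [|w [Ew _]] := U _ f; first by apply/is_zeroP/Hf/SM/mem_sub_mor.
by apply/sub_leP=> T u; rewrite mem_ker Hf -Ew -comp_assoc => ->; apply: zero_comp_r.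
Qed.

(** By [commute_modulo_iff] a Huq commutator is nothing but a normal closure
    of the Higgins commutator. *)
Lemma huq_spec (X : C) (S S' : Sub X) :
  normal_sub (huq S S') /\ sub_le (higgins (sub_mor S) (sub_mor S')) (huq S S') /\
    forall M : Sub X, normal_sub M -> sub_le (higgins (sub_mor S) (sub_mor S')) M ->
      sub_le (huq S S') M.
Proof.
have : is_huq_commutator (sub_mor S) (sub_mor S') (huq S S').
  apply: epsilon_spec.
  have [N [HN [H U]]] := normal_closure_exists (higgins (sub_mor S) (sub_mor S')).
  exists N; split=> //; split; first exact/commute_modulo_iff.
  by move=> M HM /commute_modulo_iff HM'; apply: U => //; apply: HM'.
move=> [HN [/commute_modulo_iff H U]]; split=> //; split; first exact: H.
by move=> M HM HM'; apply: U => //; apply/commute_modulo_iff.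
Qed.

Lemma huq_normal (X : C) (S S' : Sub X) : normal_sub (huq S S').
Proof. by case: (huq_spec S S'). Qed.

Lemma huq_iff (X Y : C) (S S' : Sub X) (h : Hom X Y) :
  commutes (h ∘ sub_mor S) (h ∘ sub_mor S') <-> sub_le (huq S S') (ker h).
Proof.
have [_ [H U]] := huq_spec S S'; rewrite commutes_iff; split=> H'.
- by apply: U => //; apply: normal_ker.
- by apply: sub_le_trans H'.
Qed.

Lemma huq_le_normal (X : C) (S S' M : Sub X) : normal_sub M ->
  (forall (Q : C) (q : Hom X Q), (forall (T : C) (u : Hom T X), u ∈ M <-> q ∘ u = 𝟘) ->
    covers q -> commutes (q ∘ sub_mor S) (q ∘ sub_mor S')) ->
  sub_le (huq S S') M.
Proof.
move=> /quotient_exists [Q [q [_ [cq E]]]] H.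
apply: (@sub_le_trans _ _ _ (ker q)); first by apply/huq_iff; apply: H.
by apply/sub_leP=> T u; rewrite mem_ker E.
Qed.

Lemma huq_mono (X : C) (S S' R R' : Sub X) :
  sub_le S R -> sub_le S' R' -> sub_le (huq S S') (huq R R').
Proof.
move=> [a Ea] [b Eb]; apply: huq_le_normal; first exact: huq_normal.
move=> Q q E _; rewrite -Ea -Eb !comp_assoc; apply: commutes_precomp.
by apply/huq_iff/sub_leP=> T u; rewrite mem_ker E.
Qed.

Lemma huq_eq (X : C) (S S' R R' : Sub X) :
  sub_eq S R -> sub_eq S' R' -> sub_eq (huq S S') (huq R R').
Proof. by move=> [? ?] [? ?]; split; apply: huq_mono. Qed.

Lemma huq_sym_le (X : C) (S S' : Sub X) : sub_le (huq S S') (huq S' S).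
Proof.
apply: huq_le_normal; first exact: huq_normal.
by move=> Q q E _; apply/commutes_sym/huq_iff/sub_leP=> T u; rewrite mem_ker E.
Qed.

Lemma huq_le_r (X : C) (S M : Sub X) : normal_sub M -> sub_le (huq S M) M.
Proof.
move=> HM; apply: huq_le_normal => // Q q E _.
have -> : q ∘ sub_mor M = 𝟘 by apply/E/mem_sub_mor.
exact: commutes_zero.
Qed.

(** One half of the compatibility of commutators with regular images; the
    image of a normal subobject being normal, it suffices to check that the
    images commute modulo it. *)
Lemma huq_image (X Y : C) (q : Hom X Y) (K L : Sub X) : covers q ->
  sub_le (huq (image (q ∘ sub_mor K)) (image (q ∘ sub_mor L)))
         (image (q ∘ sub_mor (huq K L))).
Proof.
move=> cq; apply: huq_le_normal; first by apply: image_normal (huq_normal K L).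
move=> Q r E _.
have [e [He Ee]] := imageP (q ∘ sub_mor K); have [e' [He' Ee']] := imageP (q ∘ sub_mor L).
apply: (commutes_covers He); apply: commutes_sym; apply: (commutes_covers He').
apply: commutes_sym; rewrite -!comp_assoc Ee Ee' !comp_assoc.
by apply/huq_iff/sub_leP=> T u [v <-]; rewrite mem_ker -comp_assoc; apply/E;
  rewrite comp_assoc; apply: mem_comp; apply: mem_image.
Qed.

(** * Kernels of joins of points under algebraic coherence *)

(** The kernel pair in [C] of a map of points is itself a point, so maps of
    points suffice to test monicity. *)
Lemma point_mono (X : C) (P Q : Pt X) (m : @Hom (Pt X) P Q) : is_mono m -> is_mono (ph_mor m).
Proof.
move=> Hm T u v E.
pose R := equalizer (ph_mor m ∘ fst) (ph_mor m ∘ snd).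
have RP (U : C) (w w' : Hom U (pt_obj P)) :
    ⟨w, w'⟩ ∈ R <-> ph_mor m ∘ w = ph_mor m ∘ w'.
  by rewrite mem_equalizer; nf.
have [s Hs] := proj2 (RP _ (pt_sec P) (pt_sec P)) eq_refl.
have ER : ph_mor m ∘ (fst ∘ sub_mor R) = ph_mor m ∘ (snd ∘ sub_mor R).
  by apply/RP; rewrite -pair_eta; apply: mem_sub_mor.
have Es : (pt_proj P ∘ (fst ∘ sub_mor R)) ∘ s = idm X.
  by nf; rewrite Hs; nf; apply: pt_split.
pose PR := MkPoint Es.
have e1 : (fst ∘ sub_mor R) ∘ pt_sec PR = pt_sec P by rewrite /=; nf; rewrite Hs; nf.
have e2 : (snd ∘ sub_mor R) ∘ pt_sec PR = pt_sec P by rewrite /=; nf; rewrite Hs; nf.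
have e3 : pt_proj P ∘ (snd ∘ sub_mor R) = pt_proj PR.
  by rewrite /= -(ph_proj m) -!(comp_assoc (pt_proj Q)) ER.
pose r1 := @MkPointHom C X PR P _ eq_refl e1.
pose r2 := @MkPointHom C X PR P _ e3 e2.
have /(f_equal (@ph_mor _ _ _ _)) /= Er : r1 = r2.
  by apply: (Hm PR r1 r2); apply: point_hom_ext.
have [h Hh] := proj2 (RP _ _ _) E.
have := f_equal (fun x => x ∘ h) Er.
by nf; rewrite Hh; nf.
Qed.

Lemma mem_factor (A B X : C) (f : Hom A X) (g : Hom B X) (J := join f g)
    (f' : Hom A J) (g' : Hom B J) (S : Sub J) :
  sub_mor J ∘ f' = f -> sub_mor J ∘ g' = g -> f' ∈ S -> g' ∈ S -> idm J ∈ S.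
Proof.
move=> Ef Eg Hf Hg; apply/mem_subcomp_mor; rewrite comp_id_r.
apply: (mem_join (f := f) (g := g)); last exact: mem_sub_mor.
- by rewrite -Ef; apply/mem_subcomp_mor.
- by rewrite -Eg; apply/mem_subcomp_mor.
Qed.

(** The consequence of algebraic coherence on which everything rests. Let two
    points over [X] map to [Z] compatibly with the sections. The kernel of
    their join is generated by the two kernels: coherence is applied to base
    change along [0 -> X]. *)
Lemma coherent_ker (hA : algebraically_coherent C) (X Z A B : C) (p : Hom Z X) (s : Hom X Z)
    (f : Hom A Z) (g : Hom B Z) (sA : Hom X A) (sB : Hom X B) (S : Sub Z) :
  p ∘ s = idm X -> f ∘ sA = s -> g ∘ sB = s ->
  (forall (T : C) (u : Hom T A), p ∘ (f ∘ u) = 𝟘 -> f ∘ u ∈ S) ->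
  (forall (T : C) (u : Hom T B), p ∘ (g ∘ u) = 𝟘 -> g ∘ u ∈ S) ->
  forall (T : C) (u : Hom T Z), u ∈ join f g -> p ∘ u = 𝟘 -> u ∈ S.
Proof.
move=> Es EsA EsB HA HB.
pose J := join f g; pose m := sub_mor J.
have [f' Ef] : f ∈ J by apply: join_l.
have [g' Eg] : g ∈ J by apply: join_r.
have E1 : (p ∘ f) ∘ sA = idm X by rewrite -comp_assoc EsA.
have E2 : (p ∘ g) ∘ sB = idm X by rewrite -comp_assoc EsB.
have E3 : (p ∘ m) ∘ (f' ∘ sA) = idm X.
  by rewrite -comp_assoc (comp_assoc m) Ef EsA.
pose PA := MkPoint E1; pose PB := MkPoint E2; pose PJ := MkPoint E3.
have c1 : pt_proj PJ ∘ f' = pt_proj PA by rewrite /= -comp_assoc Ef.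
have c2 : pt_proj PJ ∘ g' = pt_proj PB by rewrite /= -comp_assoc Eg.
have c3 : g' ∘ sB = f' ∘ sA.
  by apply: (sub_mono J); rewrite !comp_assoc Ef Eg EsA EsB.
pose F := @MkPointHom C X PA PJ f' c1 eq_refl.
pose G := @MkPointHom C X PB PJ g' c2 c3.
have FG : @jointly_strongly_epi (Pt X) PA PB PJ F G.
  move=> M D m0 h u v Hm eu ev.
  have Hm' := point_mono Hm.
  have eu' := f_equal (@ph_mor _ _ _ _) eu; have ev' := f_equal (@ph_mor _ _ _ _) ev.
  rewrite /= in eu' ev'.
  have [k Hk] : exists k : Hom J (pt_obj M), ph_mor m0 ∘ k = ph_mor h.
    have : idm J ∈ preimage (ph_mor h) (MkSub Hm').
      apply: (mem_factor Ef Eg); rewrite mem_preimage.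
      - by exists (ph_mor u).
      - by exists (ph_mor v).
    by move/mem_preimage=> [k]; rewrite comp_id_r /=; exists k.
  have k1 : pt_proj M ∘ k = pt_proj PJ.
    by rewrite -(ph_proj m0) -comp_assoc Hk (ph_proj h).
  have k2 : k ∘ pt_sec PJ = pt_sec M.
    by apply: Hm'; rewrite comp_assoc Hk (ph_sec h) (ph_sec m0).
  exists (@MkPointHom C X PJ M k k1 k2); split; first exact: point_hom_ext.
  split; apply: Hm; apply: point_hom_ext => /=.
  - by rewrite comp_assoc Hk eu'.
  - by rewrite comp_assoc Hk ev'.
have [H HH] := hA.
have [_ /(_ _ _ _ _ _ FG) FG'] := HH _ _ (zero zero_obj X).
pose z := zero zero_obj X.
pose QJ := pullback_of H z (pt_proj PJ).
pose QA := pullback_of H z (pt_proj PA).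
pose QB := pullback_of H z (pt_proj PB).
(* S1 is the trace of S on the kernel of J -> X. Over the zero object every
   subobject is a point, so strong epimorphy of the two kernels applies to it. *)
pose S1 := preimage (m ∘ pb_snd QJ) S.
have tz : is_terminal zero_obj by case: zero_obj_zero.
have iz : is_initial zero_obj by case: zero_obj_zero.
have e1 : zero S1 zero_obj ∘ zero zero_obj S1 = idm _ by apply: terminal_eq.
pose M := MkPoint e1 : Pt zero_obj.
pose D := base_obj H z PJ : Pt zero_obj.
pose m0 := @MkPointHom _ _ M D (sub_mor S1) (terminal_eq _ _ tz) (initial_eq _ _ iz).
have Hm0 : @is_mono (Pt zero_obj) M D m0.
  move=> T u v e; apply: point_hom_ext; apply: (sub_mono S1).
  exact (f_equal (@ph_mor _ _ _ _) e).
have [u Hu] : pb_pair QJ (base_map_comm QA F) ∈ S1.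
  rewrite mem_preimage -comp_assoc pb_pair_snd comp_assoc /= Ef.
  apply: HA; rewrite comp_assoc; have /= <- := proj1 (pb_is_pullback QA).
  by rewrite zero_comp_l.
have [v Hv] : pb_pair QJ (base_map_comm QB G) ∈ S1.
  rewrite mem_preimage -comp_assoc pb_pair_snd comp_assoc /= Eg.
  apply: HB; rewrite comp_assoc; have /= <- := proj1 (pb_is_pullback QB).
  by rewrite zero_comp_l.
pose u0 := @MkPointHom _ _ (base_obj H z PA) M u (terminal_eq _ _ tz) (initial_eq _ _ iz).
pose v0 := @MkPointHom _ _ (base_obj H z PB) M v (terminal_eq _ _ tz) (initial_eq _ _ iz).
have [||w [/(f_equal (@ph_mor _ _ _ _)) /= Hw _]] := FG' M D m0 (idm (D : Pt _)) u0 v0 Hm0.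
- by rewrite comp_id_l; apply: point_hom_ext.
- by rewrite comp_id_l; apply: point_hom_ext.
move=> T t [t' Et] pt.
have c : z ∘ zero T zero_obj = pt_proj PJ ∘ t' by rewrite /= -comp_assoc Et pt zero_comp_r.
have : pb_pair QJ c ∈ S1.
  by rewrite -(comp_id_l (pb_pair QJ c)) -Hw -comp_assoc; apply: mem_sub_comp.
by rewrite mem_preimage -comp_assoc pb_pair_snd Et.
Qed.

Local Notation "⟪ x , y , w , z ⟫" := ⟨⟨⟨x, y⟩, w⟩, z⟩ (format "⟪ x ,  y ,  w ,  z ⟫").

(** * Connectors of two kernel pairs *)

Lemma quad_inj (T A B D E : C) (x x' : Hom T A) (y y' : Hom T B) (w w' : Hom T D)
    (z z' : Hom T E) :
  ⟪x, y, w, z⟫ = ⟪x', y', w', z'⟫ -> x = x' /\ y = y' /\ w = w' /\ z = z'.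
Proof. by move=> /pair_inj[/pair_inj[/pair_inj[-> ->] ->] ->]. Qed.

Local Notation quad X := (X × X × X × X).

Lemma quad_eta (T X : C) (u : Hom T (quad X)) : exists x y w z : Hom T X, u = ⟪x, y, w, z⟫.
Proof.
rewrite (pair_eta u) (pair_eta (fst ∘ u)) (pair_eta (fst ∘ (fst ∘ u))).
by do 4 eexists.
Qed.

Definition kernel_pair {X Y : C} (a : Hom X Y) : Sub (X × X) := equalizer (a ∘ fst) (a ∘ snd).

Lemma mem_kernel_pair (T X Y : C) (a : Hom X Y) (u v : Hom T X) :
  ⟨u, v⟩ ∈ kernel_pair a <-> a ∘ u = a ∘ v.
Proof. by rewrite mem_equalizer; nf. Qed.

(** With [K] and [L] the kernels of [a] and [b], this is the join over [X] of
    the two kernel pairs inside [X^4], the first coordinate being the base: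
    [(x, y)] goes to [(x, y, x, y)] and [(x, w)] to [(x, x, w, w)]. In groups
    it consists of the [(x, y, w, z)] with [z = y x^-1 w] up to [[K, L]], so
    that it is a Mal'tsev connector precisely if [K] and [L] commute. *)
Definition connector {X Y Y' : C} (a : Hom X Y) (b : Hom X Y') : Sub (quad X) :=
  join (⟪fst, snd, fst, snd⟫ ∘ sub_mor (kernel_pair a))
       (⟪fst, fst, snd, snd⟫ ∘ sub_mor (kernel_pair b)).

Lemma connector_l (T X Y Y' : C) (a : Hom X Y) (b : Hom X Y') (x y : Hom T X) :
  a ∘ x = a ∘ y -> ⟪x, y, x, y⟫ ∈ connector a b.
Proof.
move=> /mem_kernel_pair [h Hh].
have -> : ⟪x, y, x, y⟫ = (⟪fst, snd, fst, snd⟫ ∘ sub_mor (kernel_pair a)) ∘ h.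
  by rewrite -comp_assoc Hh; nf.
by apply: mem_comp; apply: join_l.
Qed.

Lemma connector_r (T X Y Y' : C) (a : Hom X Y) (b : Hom X Y') (x w : Hom T X) :
  b ∘ x = b ∘ w -> ⟪x, x, w, w⟫ ∈ connector a b.
Proof.
move=> /mem_kernel_pair [h Hh].
have -> : ⟪x, x, w, w⟫ = (⟪fst, fst, snd, snd⟫ ∘ sub_mor (kernel_pair b)) ∘ h.
  by rewrite -comp_assoc Hh; nf.
by apply: mem_comp; apply: join_r.
Qed.

Lemma connector_ind (X Y Y' : C) (a : Hom X Y) (b : Hom X Y') (S : Sub (quad X)) :
  (forall (T : C) (x y : Hom T X), a ∘ x = a ∘ y -> ⟪x, y, x, y⟫ ∈ S) ->
  (forall (T : C) (x w : Hom T X), b ∘ x = b ∘ w -> ⟪x, x, w, w⟫ ∈ S) ->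
  forall (T : C) (u : Hom T (quad X)), u ∈ connector a b -> u ∈ S.
Proof.
move=> Ha Hb T u; apply: mem_join; nf; [apply: Ha|apply: Hb]; apply/mem_kernel_pair;
  rewrite -pair_eta; exact: mem_sub_mor.
Qed.

Lemma connector_rel (T X Y Y' : C) (a : Hom X Y) (b : Hom X Y') (x y w z : Hom T X) :
  ⟪x, y, w, z⟫ ∈ connector a b ->
  a ∘ x = a ∘ y /\ b ∘ x = b ∘ w /\ a ∘ w = a ∘ z /\ b ∘ y = b ∘ z.
Proof.
move=> H.
have : ⟪x, y, w, z⟫ ∈
    meet (meet (equalizer (a ∘ (fst ∘ (fst ∘ fst))) (a ∘ (snd ∘ (fst ∘ fst))))
               (equalizer (b ∘ (fst ∘ (fst ∘ fst))) (b ∘ (snd ∘ fst))))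
         (meet (equalizer (a ∘ (snd ∘ fst)) (a ∘ snd))
               (equalizer (b ∘ (snd ∘ (fst ∘ fst))) (b ∘ snd))).
  by apply: connector_ind H => U u v e; rewrite !mem_meet !mem_equalizer; nf.
by rewrite !mem_meet !mem_equalizer; nf; tauto.
Qed.

Lemma connector_swap (X Y Y' T : C) (a : Hom X Y) (b : Hom X Y') (x y w z : Hom T X) :
  ⟪x, y, w, z⟫ ∈ connector a b -> ⟪x, w, y, z⟫ ∈ connector b a.
Proof.
move=> H.
have : ⟪x, y, w, z⟫ ∈ preimage ⟪fst ∘ (fst ∘ fst), snd ∘ fst, snd ∘ (fst ∘ fst), snd⟫
                               (connector b a).
  apply: connector_ind H => U u v e; rewrite mem_preimage; nf.
  - exact: connector_r.
  - exact: connector_l.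
by rewrite mem_preimage; nf.
Qed.

Section Coherent.
Hypothesis hA : algebraically_coherent C.

(** The fibre of the connector over [0] is generated by [K] and [L]
    alone. *)
Lemma connector_zero (X Y Y' : C) (a : Hom X Y) (b : Hom X Y') (S : Sub (quad X)) :
  (forall (T : C) (y : Hom T X), a ∘ y = 𝟘 -> ⟪𝟘, y, 𝟘, y⟫ ∈ S) ->
  (forall (T : C) (w : Hom T X), b ∘ w = 𝟘 -> ⟪𝟘, 𝟘, w, w⟫ ∈ S) ->
  forall (T : C) (y w z : Hom T X), ⟪𝟘, y, w, z⟫ ∈ connector a b -> ⟪𝟘, y, w, z⟫ ∈ S.
Proof.
move=> Ha Hb T y w z H.
have Ra : ⟨idm X, idm X⟩ ∈ kernel_pair a by apply/mem_kernel_pair.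
have Rb : ⟨idm X, idm X⟩ ∈ kernel_pair b by apply/mem_kernel_pair.
case: Ra => sa Ea; case: Rb => sb Eb.
apply: (coherent_ker hA (p := fst ∘ (fst ∘ fst)) (s := ⟪idm X, idm X, idm X, idm X⟫)
  (sA := sa) (sB := sb) _ _ _ _ _ H).
- by nf.
- by rewrite -comp_assoc Ea; nf.
- by rewrite -comp_assoc Eb; nf.
- move=> U u; have : sub_mor (kernel_pair a) ∘ u ∈ kernel_pair a by apply: mem_sub_comp.
  rewrite (pair_eta (_ ∘ u)) mem_kernel_pair; nf=> e e0; rewrite e0.
  by apply: Ha; rewrite -e e0 zero_comp_r.
- move=> U u; have : sub_mor (kernel_pair b) ∘ u ∈ kernel_pair b by apply: mem_sub_comp.
  rewrite (pair_eta (_ ∘ u)) mem_kernel_pair; nf=> e e0; rewrite e0.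
  by apply: Hb; rewrite -e e0 zero_comp_r.
- by nf.
Qed.

(** By [connector_zero] the fibre of the connector over [0] is the relation
    [higgins_graph] of [K] and [L]. *)
Lemma mem_higgins_connector (X Y Y' : C) (a : Hom X Y) (b : Hom X Y') (K L : Sub X) :
  (forall (T : C) (u : Hom T X), u ∈ K <-> a ∘ u = 𝟘) ->
  (forall (T : C) (u : Hom T X), u ∈ L <-> b ∘ u = 𝟘) ->
  forall (T : C) (z : Hom T X),
    z ∈ higgins (sub_mor K) (sub_mor L) <-> ⟪𝟘, 𝟘, 𝟘, z⟫ ∈ connector a b.
Proof.
move=> HK HL T z; rewrite mem_higgins.
pose j : Hom (K × L × X) (quad X) :=
  ⟪𝟘, sub_mor K ∘ (fst ∘ fst), sub_mor L ∘ (snd ∘ fst), snd⟫.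
have jE (U : C) (k : Hom U K) (l : Hom U L) (x : Hom U X) :
    j ∘ ⟨⟨k, l⟩, x⟩ = ⟪𝟘, sub_mor K ∘ k, sub_mor L ∘ l, x⟫ by rewrite /j; nf.
have jm : is_mono j.
  move=> U u v; rewrite (pair_eta u) (pair_eta (fst ∘ u)) (pair_eta v) (pair_eta (fst ∘ v)).
  by rewrite !jE => /quad_inj[_ [/sub_mono -> [/sub_mono -> ->]]].
split=> H.
- have : ⟨𝟘, z⟩ ∈ preimage j (connector a b).
    apply: mem_join H; rewrite mem_preimage jE comp_id_r zero_comp_r.
    + by apply: connector_l; rewrite zero_comp_r; symmetry; apply/HK/mem_sub_mor.
    + by apply: connector_r; rewrite zero_comp_r; symmetry; apply/HL/mem_sub_mor.
  by rewrite mem_preimage -pair_zero jE; nf.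
- have : ⟪𝟘, 𝟘, 𝟘, z⟫ ∈ sub_comp (S := MkSub jm) (higgins_graph (sub_mor K) (sub_mor L)).
    apply: connector_zero H => U u.
    + move=> /HK [k <-]; apply/mem_subcompP; exists ⟨⟨k, 𝟘⟩, sub_mor K ∘ k⟩.
      split=> /=; last by rewrite jE zero_comp_r.
      by have := mem_comp k (join_l ⟨⟨idm K, zero K L⟩, sub_mor K⟩ ⟨⟨𝟘, idm L⟩, sub_mor L⟩); nf.
    + move=> /HL [k <-]; apply/mem_subcompP; exists ⟨⟨𝟘, k⟩, sub_mor L ∘ k⟩.
      split=> /=; last by rewrite jE zero_comp_r.
      by have := mem_comp k (join_r ⟨⟨idm K, zero K L⟩, sub_mor K⟩ ⟨⟨𝟘, idm L⟩, sub_mor L⟩); nf.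
  move=> /mem_subcompP [v [Hv /= e]]; suff <- : v = ⟨𝟘, z⟩ by [].
  by apply: (jm T); rewrite e -pair_zero jE !zero_comp_r.
Qed.

(** The elements [(0, 0, 0, z)] form a kernel in the connector, and the last
    projection is a split epimorphism mapping them isomorphically to a
    subobject of [X]; images of normal subobjects under covers are normal. *)
Lemma connector_normal (X Y Y' : C) (a : Hom X Y) (b : Hom X Y') :
  normal_sub (preimage ⟪𝟘, 𝟘, 𝟘, idm X⟫ (connector a b)).
Proof.
pose T := connector a b; pose t := sub_mor T.
have [d Hd] : ⟪idm X, idm X, idm X, idm X⟫ ∈ T by apply: connector_l.
have cz : covers (snd ∘ t).
  by apply: (covers_split (s := d)); rewrite -comp_assoc Hd; nf.
apply: normal_eq (image_normal cz (normal_ker (fst ∘ t))); apply/sub_eqP=> U u.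
rewrite mem_preimage; nf; split.
- move=> /mem_imageP [V [e [v [He E]]]]; apply: (covers_mem He); nf; rewrite E; nf.
  have := mem_sub_comp (S := T) (sub_mor (ker (fst ∘ t)) ∘ v).
  rewrite -/t (pair_eta (t ∘ _)).
  have -> : fst ∘ (t ∘ (sub_mor (ker (fst ∘ t)) ∘ v)) = 𝟘.
    by have := f_equal (fun w => w ∘ v) (ker_mor (fst ∘ t)); nf.
  by rewrite ?pair_zero; nf.
- move=> [h Hh]; have /mem_ker [v Hv] : (fst ∘ t) ∘ h = 𝟘.
    by rewrite -comp_assoc Hh; nf.
  have -> : u = (snd ∘ t ∘ sub_mor (ker (fst ∘ t))) ∘ v.
    by rewrite -!comp_assoc Hv Hh; nf.
  by apply: mem_comp; rewrite -comp_assoc; apply: mem_image.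
Qed.

(** Hence the Higgins commutator of normal subobjects is its own normal
    closure, so that it is the Huq commutator. *)
Lemma higgins_normal (X : C) (K L : Sub X) : normal_sub K -> normal_sub L ->
  normal_sub (higgins (sub_mor K) (sub_mor L)).
Proof.
move=> /normal_subP [Y [a Ha]] /normal_subP [Y' [b Hb]].
apply: normal_eq (connector_normal a b); apply/sub_eqP=> T u.
by rewrite (mem_higgins_connector Ha Hb) mem_preimage; nf.
Qed.

Lemma huq_higgins (X : C) (K L : Sub X) : normal_sub K -> normal_sub L ->
  sub_eq (huq K L) (higgins (sub_mor K) (sub_mor L)).
Proof.
move=> HK HL; have [_ [H U]] := huq_spec K L; split=> //.
by apply: U (sub_le_refl _); apply: higgins_normal.
Qed.

Lemma higgins_mono (X Y A B T : C) (m : Hom X Y) (f : Hom A X) (g : Hom B X) (u : Hom T Y) :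
  is_mono m ->
  u ∈ higgins (m ∘ f) (m ∘ g) <-> exists v : Hom T X, v ∈ higgins f g /\ m ∘ v = u.
Proof.
move=> Hm; pose j : Hom (A × B × X) (A × B × Y) := ⟨fst, m ∘ snd⟩.
have jE (U : C) (x : Hom U (A × B)) (y : Hom U X) : j ∘ ⟨x, y⟩ = ⟨x, m ∘ y⟩ by rewrite /j; nf.
have jm : is_mono j.
  move=> U x y; rewrite (pair_eta x) (pair_eta y) !jE => /pair_inj[-> /Hm ->] //.
rewrite mem_higgins; split=> [H|].
- have : ⟨𝟘, u⟩ ∈ sub_comp (S := MkSub jm) (higgins_graph f g).
    apply: mem_join H; rewrite -jE; apply/(mem_subcomp_mor (S := MkSub jm)).
    + exact: join_l.
    + exact: join_r.
  move=> /mem_subcompP [v [Hv /=]]; rewrite (pair_eta v) jE => /pair_inj[e1 e2].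
  by exists (snd ∘ v); split=> //; rewrite mem_higgins -e1 -pair_eta.
- move=> [v [Hv <-]]; move: Hv; rewrite mem_higgins => H.
  rewrite -jE -mem_preimage; apply: mem_join H; rewrite mem_preimage jE.
  + exact: join_l.
  + exact: join_r.
Qed.

(** Both commutators are Higgins commutators, and these do not see the
    ambient object. *)
Lemma coherent_independent : commutator_independent_of_ambient C.
Proof.
move=> X S K L HK HL.
have norm (M : Sub S) : normal_sub (sub_comp M) -> normal_sub M.
  move=> /(normal_preimage (sub_mor S)); apply: normal_eq; apply/sub_eqP=> T u.
  by rewrite mem_preimage mem_subcomp_mor.
have /sub_eqP E := huq_higgins (norm _ HK) (norm _ HL).
have /sub_eqP E' := huq_higgins HK HL.
apply/sub_eqP=> T u; rewrite E' /= (higgins_mono _ _ _ (sub_mono S)) mem_subcompP.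
by split=> [[v [/E Hv <-]]|[v [/E Hv <-]]]; exists v.
Qed.

(** Centralizers are closed under joins. The points [A × L] and [A × M] over
    [A] map to [A × X], with section [(1, f)]. In the join of their graphs the
    kernel is generated by the elements [(0, l, l)] and [(0, m, m)], so that
    it is a graph too, and then the whole join is the graph of a morphism
    defined on [A] times the join. *)
Lemma commutes_join (A L M I X : C) (f : Hom A X) (l : Hom L X) (m : Hom M X) (j : Hom I X) :
  commutes f l -> commutes f m -> j ∈ join l m -> commutes f j.
Proof.
move=> [φ [φ1 φ2]] [ψ [ψ1 ψ2]] Hj.
have φE (T : C) (u : Hom T (A × L)) : fst ∘ u = 𝟘 -> φ ∘ u = l ∘ (snd ∘ u).
  by move=> e; rewrite {1}(pair_eta u) e -φ2; nf.
have ψE (T : C) (u : Hom T (A × M)) : fst ∘ u = 𝟘 -> ψ ∘ u = m ∘ (snd ∘ u).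
  by move=> e; rewrite {1}(pair_eta u) e -ψ2; nf.
pose F : Hom (A × L) (A × X × X) := ⟨⟨fst, l ∘ snd⟩, φ⟩.
pose G : Hom (A × M) (A × X × X) := ⟨⟨fst, m ∘ snd⟩, ψ⟩.
(* T is the graph over A of the morphism being constructed, and T0 says that its
   fibre over 0 is the diagonal. *)
pose T := join F G.
have T0 (U : C) (y z : Hom U X) : ⟨⟨𝟘, y⟩, z⟩ ∈ T -> y = z.
  move=> H; have : ⟨⟨zero U A, y⟩, z⟩ ∈ equalizer (snd ∘ fst) snd.
    apply: (coherent_ker hA (p := fst ∘ fst) (s := ⟨⟨idm A, 𝟘⟩, f⟩)
      (sA := ⟨idm A, 𝟘⟩) (sB := ⟨idm A, 𝟘⟩) _ _ _ _ _ H).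
    - by nf.
    - by rewrite /F; nf; rewrite φ1.
    - by rewrite /G; nf; rewrite ψ1.
    - by move=> V u; rewrite /F; nf=> e; rewrite mem_equalizer; nf; rewrite φE.
    - by move=> V u; rewrite /G; nf=> e; rewrite mem_equalizer; nf; rewrite ψE.
    - by nf.
  by rewrite mem_equalizer; nf.
have Tm : is_mono (fst ∘ sub_mor T).
  apply: mono_of_trivial_ker => U u; rewrite -comp_assoc => e.
  apply: (sub_mono T); rewrite zero_comp_r (pair_eta (_ ∘ u)) e.
  suff <- : 𝟘 = snd ∘ (sub_mor T ∘ u) by rewrite pair_zero.
  by apply: T0; rewrite pair_zero -e -pair_eta; apply: mem_sub_comp.
have [f' Hf] := join_l F G : F ∈ T; have [g' Hg] := join_r F G : G ∈ T.
have [h Hh] : ⟨fst, j ∘ snd⟩ ∈ MkSub Tm.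
  have : idm (A × I) ∈ preimage ⟨fst, j ∘ snd⟩ (MkSub Tm).
    apply: product_ind; rewrite mem_preimage; nf.
    - by exists (f' ∘ ⟨idm A, 𝟘⟩) => /=; rewrite -!comp_assoc (comp_assoc (sub_mor T)) Hf /F; nf.
    - have : j ∈ preimage ⟨𝟘, idm X⟩ (MkSub Tm).
        apply: mem_join Hj; rewrite mem_preimage; nf.
        + by exists (f' ∘ ⟨𝟘, idm L⟩) => /=; rewrite -!comp_assoc (comp_assoc (sub_mor T)) Hf /F; nf.
        + by exists (g' ∘ ⟨𝟘, idm M⟩) => /=; rewrite -!comp_assoc (comp_assoc (sub_mor T)) Hg /G; nf.
      by rewrite mem_preimage; nf.
  by rewrite mem_preimage; nf.
move: Hh => /=; rewrite -comp_assoc => Hh.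
exists (snd ∘ (sub_mor T ∘ h)); split.
- have -> : (snd ∘ (sub_mor T ∘ h)) ∘ ⟨idm A, 𝟘⟩ = snd ∘ (sub_mor T ∘ (f' ∘ ⟨idm A, 𝟘⟩)).
    rewrite -!comp_assoc; do 2 congr (_ ∘ _); apply: (Tm A).
    have := f_equal (fun x => x ∘ ⟨idm A, zero A I⟩) Hh; nf=> ->.
    by rewrite (comp_assoc (sub_mor T)) Hf /F; nf.
  by rewrite (comp_assoc (sub_mor T)) Hf /F; nf.
- symmetry; apply: T0.
  have := f_equal (fun x => x ∘ ⟨𝟘, idm I⟩) Hh; nf=> <-.
  rewrite -(pair_eta (sub_mor T ∘ (h ∘ _))).
  exact: mem_sub_comp.
Qed.

Lemma coherent_joins : commutator_preserves_joins C.
Proof.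
move=> X K L M HK HL HM.
have [a [b c]] := sub_joinP L M.
have [a' [b' c']] := sub_joinP (huq K L) (huq K M).
split; last by apply: c'; apply: huq_mono => //; apply: sub_le_refl.
apply: huq_le_normal; first by apply: sub_join_normal; apply: huq_normal.
move=> Q q E _; have le : sub_le (sub_join (huq K L) (huq K M)) (ker q).
  by apply/sub_leP=> T u; rewrite mem_ker E.
apply: (@commutes_join _ _ _ _ _ _ (q ∘ sub_mor L) (q ∘ sub_mor M)).
- by apply/huq_iff; apply: sub_le_trans le.
- by apply/huq_iff; apply: sub_le_trans le.
- rewrite -mem_preimage.
  have [/sub_leP H _] := sub_join_eq L M; have := H _ _ (mem_sub_mor _).
  by apply: mem_join; rewrite mem_preimage; [apply: join_l|apply: join_r].
Qed.

(** If the kernels of [a] and [c] commute, the fibre over [0] is the graph of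
    the cooperator, hence single-valued. *)
Lemma connector_zero_commutes (X Y Y' T : C) (a : Hom X Y) (c : Hom X Y') (y w z : Hom T X) :
  commutes (sub_mor (ker a)) (sub_mor (ker c)) ->
  ⟪𝟘, y, w, z⟫ ∈ connector a c -> w = 𝟘 -> z = y.
Proof.
move=> [φ [φ1 φ2]] H w0.
pose j : Hom (ker a × ker c) (quad X) :=
  ⟪𝟘, sub_mor (ker a) ∘ fst, sub_mor (ker c) ∘ snd, φ⟫.
have jE (U : C) (k : Hom U (ker a)) (l : Hom U (ker c)) :
    j ∘ ⟨k, l⟩ = ⟪𝟘, sub_mor (ker a) ∘ k, sub_mor (ker c) ∘ l, φ ∘ ⟨k, l⟩⟫.
  by rewrite /j; nf.
have jm : is_mono j.
  move=> U u v; rewrite (pair_eta u) (pair_eta v) !jE.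
  by move=> /quad_inj[_ [/sub_mono -> [/sub_mono -> _]]].
have φE1 (U : C) (k : Hom U (ker a)) : φ ∘ ⟨k, 𝟘⟩ = sub_mor (ker a) ∘ k.
  by rewrite -φ1; nf.
have φE2 (U : C) (l : Hom U (ker c)) : φ ∘ ⟨𝟘, l⟩ = sub_mor (ker c) ∘ l.
  by rewrite -φ2; nf.
have : ⟪𝟘, y, w, z⟫ ∈ MkSub jm.
  apply: connector_zero H => U u /mem_ker [k Hk].
  - by exists ⟨k, 𝟘⟩; rewrite /= jE φE1 Hk zero_comp_r.
  - by exists ⟨𝟘, k⟩; rewrite /= jE φE2 Hk zero_comp_r.
move=> [h] /=; rewrite (pair_eta h) jE => /quad_inj[_ [<- [e <-]]].
have -> : snd ∘ h = 𝟘 by apply: (sub_mono (ker c)); rewrite e w0 zero_comp_r.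
exact: φE1.
Qed.

(** Let [A], [L], [M] be the kernels of [a], [b], [c]. In groups the diagonal
    elements [(0, x, 0, x)] with [x] in [A] are normal in the connector of
    [L] and [M] because [A] is normalized by [L] and centralized by [M].
    Here they form the class of zero of a relation between [(x, y, w, z)]
    and [(x, y', w, z')], namely that [z'] and [y'] arise from [z] and [y] by
    multiplication by the same element of [A]. As [z] and [y] are congruent
    modulo [M], the connector of [A] and [M] expresses this. *)
Lemma connector_diag_normal (X Y1 Y2 Y3 : C) (a : Hom X Y1) (b : Hom X Y2) (c : Hom X Y3) :
  (forall (T : C) (u : Hom T X), a ∘ u = 𝟘 -> b ∘ u = 𝟘) ->
  commutes (sub_mor (ker a)) (sub_mor (ker c)) ->
  exists N : Sub (connector b c), normal_sub N /\
    forall (T : C) (t : Hom T (connector b c)), t ∈ N <->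
      exists x : Hom T X, a ∘ x = 𝟘 /\ sub_mor (connector b c) ∘ t = ⟪𝟘, x, 𝟘, x⟫.
Proof.
move=> ab Hac; pose T := connector b c; pose m := sub_mor T.
pose px : Hom (quad X) X := fst ∘ (fst ∘ fst); pose py : Hom (quad X) X := snd ∘ (fst ∘ fst).
pose pw : Hom (quad X) X := snd ∘ fst; pose pz : Hom (quad X) X := snd.
pose G := meet (meet (equalizer (px ∘ (m ∘ fst)) (px ∘ (m ∘ snd)))
                     (equalizer (pw ∘ (m ∘ fst)) (pw ∘ (m ∘ snd))))
  (preimage ⟪pz ∘ (m ∘ fst), pz ∘ (m ∘ snd), py ∘ (m ∘ fst), py ∘ (m ∘ snd)⟫ (connector a c)).
have GP (U : C) (t t' : Hom U T) : ⟨t, t'⟩ ∈ G <->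
    (px ∘ (m ∘ t) = px ∘ (m ∘ t') /\ pw ∘ (m ∘ t) = pw ∘ (m ∘ t')) /\
    ⟪pz ∘ (m ∘ t), pz ∘ (m ∘ t'), py ∘ (m ∘ t), py ∘ (m ∘ t')⟫ ∈ connector a c.
  by rewrite !mem_meet !mem_equalizer mem_preimage; nf.
have [|Q [h Hh]] := @reflexive_effective _ G.
  apply/GP; split=> //; apply: connector_r; nf.
  have := mem_sub_mor T; rewrite -/m.
  have [x [y [w [z ->]]]] := quad_eta m.
  by rewrite /pz /py; nf; move=> /connector_rel [_ [_ [_ ->]]].
exists (ker h); split; first exact: normal_ker.
move=> U t; rewrite mem_ker.
have -> : h ∘ t = 𝟘 <-> ⟨𝟘, t⟩ ∈ G by rewrite Hh zero_comp_r; split.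
rewrite GP -/T -/m.
have [x [y [w [z ->]]]] := quad_eta (m ∘ t); rewrite /px /py /pz /pw; nf; split.
- move=> [[<- <-] H].
  have E : y = z by apply: (connector_zero_commutes Hac H).
  exists z; rewrite E; split=> //.
  by case: (connector_rel H) => <- _; rewrite zero_comp_r.
- move=> [x' [e]] /quad_inj[-> [-> [-> ->]]].
  split=> //; have : ⟪𝟘, x', 𝟘, x'⟫ ∈ connector a c.
    by apply: connector_l; rewrite e zero_comp_r.
  by nf.
Qed.

(** * The three subobjects lemma *)

(** If [K] and [L] commute modulo the kernel of [a], then the diagonal copy of
    [K] and the copy [{(0, l)}] of [L] commute in the kernel pair of [b]
    modulo the elements [(0, x)] with [a x = 0]: this can be tested after the
    map [(x, y) |-> (x, a y)], where the first coordinate is harmless. *)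
Lemma commutes_on_kernel_pair (X Y Y' K L T Q : C) (k : Hom K X) (l : Hom L X)
    (a : Hom X Y) (b : Hom X Y') (i : Hom (kernel_pair b) T) (q : Hom T Q)
    (σ : Hom X (kernel_pair b)) (λ : Hom L (kernel_pair b)) :
  sub_mor (kernel_pair b) ∘ σ = ⟨idm X, idm X⟩ ->
  sub_mor (kernel_pair b) ∘ λ = ⟨𝟘, l⟩ ->
  commutes (a ∘ k) (a ∘ l) ->
  (forall (U : C) (u : Hom U (kernel_pair b)) (x : Hom U X),
     sub_mor (kernel_pair b) ∘ u = ⟨𝟘, x⟩ -> a ∘ x = 𝟘 -> (q ∘ i) ∘ u = 𝟘) ->
  commutes ((q ∘ i) ∘ (σ ∘ k)) ((q ∘ i) ∘ λ).
Proof.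
move=> Eσ Eλ [φ [φ1 φ2]] Hq.
pose g := ⟨fst, a ∘ snd⟩ ∘ sub_mor (kernel_pair b).
apply/commutes_iff/(@sub_le_trans _ _ _ (ker g)).
- apply/commutes_iff; exists ⟨k ∘ fst, φ⟩; nf.
  by rewrite φ1 φ2 /g -!comp_assoc Eλ (comp_assoc _ σ) Eσ; nf.
- apply/sub_leP=> U u; rewrite !mem_ker /g -comp_assoc.
  rewrite (pair_eta (_ ∘ u)); nf; rewrite -(pair_zero U X Y) => /pair_inj[e1 e2].
  rewrite comp_assoc; apply: Hq e2.
  by rewrite -e1 -pair_eta.
Qed.

(** Let [T] be the connector of [L] and [M] and let [A = [K, L]], [B = [K, M]].
    The diagonal copies of [A] and [B] are normal in [T]. Modulo their join
    the diagonal copy of [K] commutes with the copies of [L] and [M], hence by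
    [commutes_join] with everything they generate, and this includes the
    elements [(0, 0, 0, j)] with [j] in [[L, M]]. These also form a normal
    subobject of [T], which meets the join of the copies of [A] and [B]
    trivially since [A] and [M] commute. So [K] and [[L, M]] commute in [T],
    and the last projection carries this to [X]. *)
Lemma three_subobjects_commuting (X : C) (K L M : Sub X) :
  normal_sub K -> normal_sub L -> normal_sub M ->
  commutes (sub_mor (huq K L)) (sub_mor M) ->
  commutes (sub_mor (huq K M)) (sub_mor L) ->
  commutes (sub_mor K) (sub_mor (huq L M)).
Proof.
move=> HK HL HM KLM KML.
have [Y1 [b Hb]] := proj1 (normal_subP L) HL.
have [Y2 [c Hc]] := proj1 (normal_subP M) HM.
have [Y3 [a Ha]] := proj1 (normal_subP _) (huq_normal K L).
have [Y4 [d Hd]] := proj1 (normal_subP _) (huq_normal K M).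
have same_ker (N N' : Sub X) (Y Y' : C) (f : Hom X Y) (g : Hom X Y') :
    (forall (T : C) (u : Hom T X), u ∈ N <-> f ∘ u = 𝟘) ->
    (forall (T : C) (u : Hom T X), u ∈ N' <-> g ∘ u = 𝟘) ->
    commutes (sub_mor N) (sub_mor N') -> commutes (sub_mor (ker f)) (sub_mor (ker g)).
  move=> Hf Hg H.
  have /Hf [v <-] := ker_mor f; have /Hg [w <-] := ker_mor g.
  exact: commutes_precomp.
have ac := same_ker _ _ _ _ _ _ Ha Hc KLM.
have db := same_ker _ _ _ _ _ _ Hd Hb KML.
have ab (T : C) (u : Hom T X) : a ∘ u = 𝟘 -> b ∘ u = 𝟘.
  by move=> /Ha; move/sub_leP: (huq_le_r K HL) => H /H /Hb.
have dc (T : C) (u : Hom T X) : d ∘ u = 𝟘 -> c ∘ u = 𝟘.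
  by move=> /Hd; move/sub_leP: (huq_le_r K HM) => H /H /Hc.
pose T := connector b c; pose m := sub_mor T.
have [NA [nNA HNA]] := connector_diag_normal ab ac.
have [NB' [nNB' HNB']] := connector_diag_normal dc db.
(* Exchanging the two middle coordinates turns the normal subobject obtained
   for (c, b) into the one needed for the second summand. *)
have [sw Hsw] : ⟪fst ∘ (fst ∘ fst), snd ∘ fst, snd ∘ (fst ∘ fst), snd⟫ ∘ m ∈ connector c b.
  have := mem_sub_mor T; rewrite -/m.
  have [x [y [w [z ->]]]] := quad_eta m.
  by nf; apply: connector_swap.
pose NB := preimage sw NB'.
have nNB : normal_sub NB by apply: normal_preimage.
have HNB (U : C) (t : Hom U T) : t ∈ NB <->
    exists x : Hom U X, d ∘ x = 𝟘 /\ m ∘ t = ⟪𝟘, 𝟘, x, x⟫.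
  rewrite mem_preimage HNB'.
  rewrite (comp_assoc (sub_mor (connector c b))) Hsw.
  have [x [y [w [z Et]]]] := quad_eta (m ∘ t).
  rewrite -comp_assoc Et; nf; split=> [[x' [e]] /quad_inj[-> [-> [-> ->]]]|
    [x' [e]]]; first by exists x'; nf.
  rewrite -(pair_zero U X X) => /quad_inj[-> [-> [-> ->]]].
  by exists x'; nf.
have [Q [q [_ [_ Hq]]]] := quotient_exists (join_normal nNA nNB).
have qA (U : C) (t : Hom U T) (x : Hom U X) : a ∘ x = 𝟘 -> m ∘ t = ⟪𝟘, x, 𝟘, x⟫ -> q ∘ t = 𝟘.
  move=> e Et; apply/Hq; have [v <-] : t ∈ NA by apply/HNA; exists x.
  by apply: mem_comp; apply: join_l.
have qB (U : C) (t : Hom U T) (x : Hom U X) : d ∘ x = 𝟘 -> m ∘ t = ⟪𝟘, 𝟘, x, x⟫ -> q ∘ t = 𝟘.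
  move=> e Et; apply/Hq; have [v <-] : t ∈ NB by apply/HNB; exists x.
  by apply: mem_comp; apply: join_r.
have [il Hil] := join_l (⟪fst, snd, fst, snd⟫ ∘ sub_mor (kernel_pair b))
       (⟪fst, fst, snd, snd⟫ ∘ sub_mor (kernel_pair c)).
have [ir Hir] := join_r (⟪fst, snd, fst, snd⟫ ∘ sub_mor (kernel_pair b))
       (⟪fst, fst, snd, snd⟫ ∘ sub_mor (kernel_pair c)).
rewrite -/(connector b c) -/T in il ir Hil Hir.
have [σl Eσl] : ⟨idm X, idm X⟩ ∈ kernel_pair b by apply/mem_kernel_pair.
have [σr Eσr] : ⟨idm X, idm X⟩ ∈ kernel_pair c by apply/mem_kernel_pair.
have [λ0 Eλ0] : ⟨𝟘, sub_mor L⟩ ∈ kernel_pair b.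
  by apply/mem_kernel_pair; rewrite zero_comp_r; symmetry; apply/Hb/mem_sub_mor.
have [μ0 Eμ0] : ⟨𝟘, sub_mor M⟩ ∈ kernel_pair c.
  by apply/mem_kernel_pair; rewrite zero_comp_r; symmetry; apply/Hc/mem_sub_mor.
pose σ := il ∘ σl.
have Eσ : m ∘ σ = ⟪idm X, idm X, idm X, idm X⟫.
  by rewrite /σ comp_assoc Hil -comp_assoc Eσl; nf.
have Eσ' : σ = ir ∘ σr.
  apply: (sub_mono T); rewrite [LHS]Eσ comp_assoc Hir -comp_assoc Eσr; nf. by [].
pose λ := il ∘ λ0; pose μ := ir ∘ μ0.
have Eλ : m ∘ λ = ⟪𝟘, sub_mor L, 𝟘, sub_mor L⟫.
  by rewrite /λ comp_assoc Hil -comp_assoc Eλ0; nf.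
have Eμ : m ∘ μ = ⟪𝟘, 𝟘, sub_mor M, sub_mor M⟫.
  by rewrite /μ comp_assoc Hir -comp_assoc Eμ0; nf.
have cl : commutes (q ∘ (σ ∘ sub_mor K)) (q ∘ λ).
  have := @commutes_on_kernel_pair _ _ _ _ _ _ _ (sub_mor K) _ a b il q σl λ0 Eσl Eλ0.
  rewrite /σ /λ -!comp_assoc; apply.
    by apply/huq_iff/sub_leP=> U u /Ha; rewrite mem_ker.
  move=> U u x Eu ax; rewrite -comp_assoc; apply: (qA _ _ x) => //.
  by rewrite comp_assoc Hil -comp_assoc Eu; nf.
have cr : commutes (q ∘ (σ ∘ sub_mor K)) (q ∘ μ).
  have := @commutes_on_kernel_pair _ _ _ _ _ _ _ (sub_mor K) _ d c ir q σr μ0 Eσr Eμ0.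
  rewrite Eσ' /μ -!comp_assoc; apply.
    by apply/huq_iff/sub_leP=> U u /Hd; rewrite mem_ker.
  move=> U u x Eu ax; rewrite -comp_assoc; apply: (qB _ _ x) => //.
  by rewrite comp_assoc Hir -comp_assoc Eu; nf.
pose J := huq L M.
have HJ : ⟪𝟘, 𝟘, 𝟘, sub_mor J⟫ ∈ connector b c.
  apply/(mem_higgins_connector Hb Hc).
  by have [/sub_leP H _] := huq_higgins HL HM; apply/H/mem_sub_mor.
have [ι Eι] := HJ.
have Hι : ι ∈ join λ μ.
  apply/(mem_subcomp_mor (S := T)); rewrite [_ ∘ _]Eι.
  apply: connector_zero HJ => U u.
  - move=> /Hb [v <-]; have := mem_comp v (join_l λ μ) => /mem_subcomp_mor.
    by rewrite comp_assoc [_ ∘ λ]Eλ; nf.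
  - move=> /Hc [v <-]; have := mem_comp v (join_r λ μ) => /mem_subcomp_mor.
    by rewrite comp_assoc [_ ∘ μ]Eμ; nf.
have cι : commutes (q ∘ (σ ∘ sub_mor K)) (q ∘ ι).
  apply: (commutes_join cl cr); rewrite -mem_preimage.
  by apply: mem_join Hι; rewrite mem_preimage; [apply: join_l|apply: join_r].
have cι' : commutes ((fst ∘ m) ∘ (σ ∘ sub_mor K)) ((fst ∘ m) ∘ ι).
  have -> : (fst ∘ m) ∘ ι = 𝟘 by rewrite -comp_assoc [m ∘ _]Eι; nf.
  exact: commutes_zero.
(* The commutator of K and J lies in the join of the diagonal copies since K and
   J commute modulo it, and among the (0, 0, 0, z) since J consists of such. *)
have cσι : commutes (σ ∘ sub_mor K) ι.
  rewrite -(comp_id_l (σ ∘ _)) -(comp_id_l ι); apply/commutes_iff.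
  apply/sub_leP=> U u Hu; rewrite mem_ker comp_id_l.
  have /mem_ker /Hq u1 : u ∈ ker q by move/commutes_iff/sub_leP: cι; apply.
  have /mem_ker u2 : u ∈ ker (fst ∘ m) by move/commutes_iff/sub_leP: cι'; apply.
  have u3 : m ∘ u ∈ connector a c.
    rewrite -mem_preimage; apply: mem_join u1; rewrite mem_preimage.
    - have /HNA [x [e ->]] := mem_sub_mor NA.
      by apply: connector_l; rewrite e zero_comp_r.
    - have /HNB [x [e ->]] := mem_sub_mor NB.
      by apply: connector_r; rewrite (dc _ _ e) zero_comp_r.
  apply: (sub_mono T); rewrite zero_comp_r -/m (pair_eta (m ∘ u)) comp_assoc u2.
  suff -> : snd ∘ (m ∘ u) = 𝟘 by rewrite pair_zero.
  apply: (connector_zero_commutes ac (w := 𝟘)) => //.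
  by rewrite !pair_zero -u2 -comp_assoc -pair_eta.
have := commutes_comp (snd ∘ m) cσι.
by rewrite comp_assoc -!(comp_assoc snd) [m ∘ ι]Eι Eσ; nf.
Qed.

(** Pass to the quotient by the right-hand side, where the two commutators
    on the right vanish. *)
Lemma coherent_three_subobjects : three_subobjects C.
Proof.
move=> X K L M HK HL HM.
have [l [r _]] := sub_joinP (huq (huq K L) M) (huq L (huq K M)).
apply: huq_le_normal; first by apply: sub_join_normal; apply: huq_normal.
move=> Q q E cq; set U := sub_join _ _ in l r E.
have UE : sub_le U (ker q) by apply/sub_leP=> T u; rewrite mem_ker E.
pose im (S : Sub X) := image (q ∘ sub_mor S).
have nim (S : Sub X) : normal_sub S -> normal_sub (im S) by apply: image_normal.
have H : commutes (sub_mor (im K)) (sub_mor (huq (im L) (im M))).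
  apply: three_subobjects_commuting; try exact: nim.
  - have [h <-] := huq_image K L cq.
    rewrite -(comp_id_r (sub_mor (image (_ ∘ sub_mor M)))).
    apply/commutes_precomp/commutes_images/huq_iff.
    exact: sub_le_trans UE.
  - have [h <-] := huq_image K M cq.
    rewrite -(comp_id_r (sub_mor (image (_ ∘ sub_mor L)))).
    apply/commutes_precomp/commutes_images/commutes_sym/huq_iff.
    exact: sub_le_trans UE.
have [e Ee] := mem_image (q ∘ sub_mor K).
have [f Ef] : q ∘ sub_mor (huq L M) ∈ huq (im L) (im M).
  have [R [s [_ [_ Hs]]]] := quotient_exists (huq_normal (im L) (im M)).
  apply/Hs; rewrite comp_assoc; apply/mem_ker.
  suff /sub_leP : sub_le (huq L M) (ker (s ∘ q)) by apply; apply: mem_sub_mor.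
  apply/huq_iff; rewrite -!comp_assoc.
  have [v <-] := mem_image (q ∘ sub_mor L); have [w <-] := mem_image (q ∘ sub_mor M).
  rewrite !comp_assoc; apply/commutes_precomp/huq_iff/sub_leP=> T u /Hs.
  by rewrite mem_ker.
by rewrite -Ee -Ef; apply: commutes_precomp.
Qed.

End Coherent.

(** * Descending central series *)

Lemma sub_is_zeroP (X : C) (S : Sub X) :
  sub_is_zero S <-> forall (T : C) (u : Hom T X), u ∈ S -> u = 𝟘.
Proof.
rewrite /sub_is_zero is_zero_objectP; split=> [e T u [h <-]|H].
- by rewrite -(comp_id_l h) e zero_comp_l zero_comp_r.
- by apply: (sub_mono S); rewrite comp_id_r zero_comp_r; apply/H/mem_sub_mor.
Qed.

Lemma sub_is_zero_le (X : C) (S S' : Sub X) : sub_le S S' -> sub_is_zero S' -> sub_is_zero S.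
Proof. by move=> /sub_leP H /sub_is_zeroP H'; apply/sub_is_zeroP=> T u /H /H'. Qed.

Lemma normal_top (X : C) : normal_sub (sub_top X).
Proof.
apply/normal_subP; exists zero_obj, 𝟘 => T u; rewrite zero_comp_l.
by split=> // _; apply: mem_top.
Qed.

Lemma sub_le_top (X : C) (S : Sub X) : sub_le S (sub_top X).
Proof. by apply/sub_leP=> T u _; apply: mem_top. Qed.

Local Notation γ n S := (Nat.iter n (@gamma C _) S).

Lemma gamma_mono (X : C) (n : nat) (S S' : Sub X) : sub_le S S' -> sub_le (γ n S) (γ n S').
Proof. by move=> H; elim: n => //= n; apply: huq_mono; apply: sub_le_refl. Qed.

Lemma gamma_normal (X : C) (n : nat) (S : Sub X) : normal_sub S -> normal_sub (γ n S).
Proof. by case: n => //= n _; apply: huq_normal. Qed.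

Lemma gamma_le (X : C) (n : nat) (S : Sub X) : normal_sub S -> sub_le (γ n S) S.
Proof.
move=> HS; elim: n => [|n IH]; first exact: sub_le_refl.
by apply: sub_le_trans IH; apply: huq_le_r; apply: gamma_normal.
Qed.

Lemma gamma_antitone (X : C) (m n : nat) (S : Sub X) : normal_sub S -> m <= n ->
  sub_le (γ n S) (γ m S).
Proof.
move=> HS mn; have -> : n = (n - m) + m by lia.
by rewrite Nat.iter_add; apply: gamma_le; apply: gamma_normal.
Qed.

Lemma lower_central_preimage (X Y : C) (p : Hom X Y) (n : nat) :
  sub_le (lower_central X n) (preimage p (lower_central Y n)).
Proof.
elim: n => [|n IH]; first by apply/sub_leP=> T u _; rewrite mem_preimage; apply: mem_top.
have [Q [q [_ [_ Hq]]]] := quotient_exists (huq_normal (sub_top Y) (lower_central Y n)).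
apply: (@sub_le_trans _ _ _ (ker (q ∘ p))); last first.
  by apply/sub_leP=> T u; rewrite mem_ker mem_preimage -comp_assoc /= Hq.
apply/huq_iff; rewrite -!comp_assoc /=.
have /mem_preimage [h <-] : sub_mor (lower_central X n) ∈ preimage p (lower_central Y n).
  by move/sub_leP: IH; apply; apply: mem_sub_mor.
rewrite comp_id_r -(comp_id_l p) !comp_assoc; apply/commutes_precomp.
apply/(huq_iff (sub_top Y) (lower_central Y n))/sub_leP=> T u /Hq; by rewrite mem_ker.
Qed.

Section Bound.
Hypothesis hind : commutator_independent_of_ambient C.
Hypothesis hjoin : commutator_preserves_joins C.
Hypothesis hthree : three_subobjects C.

Lemma gamma_join (X : C) (n : nat) (U V : Sub X) : normal_sub U -> normal_sub V ->
  sub_le (γ n (sub_join U V)) (sub_join (γ n U) (γ n V)).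
Proof.
move=> HU HV; elim: n => [|n IH]; first exact: sub_le_refl.
apply: (@sub_le_trans _ _ _ (gamma (sub_join (γ n U) (γ n V)))).
  by apply: huq_mono IH; apply: sub_le_refl.
by case: (@hjoin X (sub_top X) (γ n U) (γ n V)) => //;
  [apply: normal_top|apply: gamma_normal|apply: gamma_normal].
Qed.

Lemma join_le (X : C) (U V S : Sub X) : sub_le U S -> sub_le V S -> sub_le (sub_join U V) S.
Proof. by have [_ [_ H]] := sub_joinP U V; apply: H. Qed.

(** The Leibniz rule: by the three subobjects lemma [[E, -]] acts on a
    commutator like a derivation. *)
Lemma gamma_huq (X : C) (n : nat) (A B M : Sub X) : normal_sub A -> normal_sub B ->
  (forall j k, j + k = n -> sub_le (huq (γ j A) (γ k B)) M) -> sub_le (γ n (huq A B)) M.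
Proof.
elim: n A B => [|n IH] A B HA HB H; first exact: (H 0 0).
rewrite Nat.iter_succ_r.
apply: (@sub_le_trans _ _ _ (γ n (sub_join (huq (gamma A) B) (huq A (gamma B))))).
  by apply: gamma_mono; apply: hthree => //; apply: normal_top.
apply: sub_le_trans (gamma_join n (huq_normal _ _) (huq_normal _ _)) _.
apply: join_le; apply: IH => //; try exact: huq_normal; move=> j k E.
- by have := H (S j) k; rewrite Nat.iter_succ_r; apply; rewrite -E.
- by have := H j (S k); rewrite Nat.iter_succ_r; apply; rewrite -E; lia.
Qed.

Section Extension.
Context {E : C} (N : Sub E) (hN : normal_sub N).

(** The lower central series of [N], computed in [E]; the index is shifted,
    [own_series 0] being [N]. *)
Fixpoint own_series (i : nat) : Sub E :=
  match i with 0 => N | S i => huq N (own_series i) end.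

Lemma own_series_normal i : normal_sub (own_series i).
Proof. by case: i => // i; apply: huq_normal. Qed.

Lemma own_series_lower_central i : sub_eq (sub_comp (lower_central N i)) (own_series i).
Proof.
have HT : sub_eq (sub_comp (sub_top N)) N.
  by apply/sub_eqP=> T u; rewrite /mem /= comp_id_r.
elim: i => [|i IH] //.
have nT := normal_eq (sub_eq_sym HT) hN.
have nI := normal_eq (sub_eq_sym IH) (own_series_normal i).
apply: sub_eq_trans (hind nT nI) _.
exact: huq_eq.
Qed.

Lemma huq_own_series i : sub_le (huq (own_series 1) (own_series i)) (own_series (S (S i))).
Proof.
apply: sub_le_trans (huq_sym_le _ _) _.
apply: sub_le_trans (hthree (own_series_normal i) hN hN) _.
have le : sub_le (huq (own_series i) N) (own_series (S i)) by apply: huq_sym_le.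
apply: join_le; last by apply: huq_mono le; apply: sub_le_refl.
apply: sub_le_trans (huq_sym_le _ _) _.
by apply: huq_mono le; apply: sub_le_refl.
Qed.

Variable d : nat.
Hypothesis hd : sub_le (lower_central E (S d)) (own_series 1).

(** By the Leibniz rule, applying [[E, -]] to a commutator of [i + 1] copies of
    [N] more than [(i + 1) d] times applies it more than [d] times to one of
    the copies, which lands this copy in [[N, N]]. *)
Lemma gamma_own_series i n : (S i) * d + 1 <= n -> sub_le (γ n (own_series i)) (own_series (S i)).
Proof.
have base j : S d <= j -> sub_le (γ j N) (own_series 1).
  move=> Hj; apply: (@sub_le_trans _ _ _ (γ j (sub_top E))).
    by apply: gamma_mono; apply: sub_le_top.
  apply: sub_le_trans hd; apply: gamma_antitone => //; exact: normal_top.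
elim: i n => [|i IH] n Hn; first by apply: base; lia.
apply: gamma_huq => //; first exact: own_series_normal.
move=> j k Ejk; have [Hj|Hj] := Nat.le_gt_cases (S d) j.
- apply: sub_le_trans (huq_own_series i); apply: huq_mono; first exact: base.
  by apply: gamma_le; apply: own_series_normal.
- apply: huq_mono; first exact: gamma_le.
  by apply: IH; lia.
Qed.

(** The number of steps needed is the sum of the numbers [i d + 1] for [i]
    from [1] to [c]; here [d + 1] bounds the class of the quotient. *)
Definition bound (c : nat) : nat := Nat.div (c * (c + 1)) 2 * d + c.

Lemma bound_succ c : bound (S c) = (S c * d + 1) + bound c.
Proof.
rewrite /bound; have -> : S c * (S c + 1) = c * (c + 1) + S c * 2 by lia.
rewrite Nat.div_add; lia.
Qed.

Lemma lower_central_own_series c : sub_le (lower_central E (bound (S c))) (own_series (S c)).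
Proof.
elim: c => [|c IH].
  have -> : bound 1 = S d by rewrite /bound /=; lia.
  exact: hd.
rewrite bound_succ /lower_central Nat.iter_add.
apply: sub_le_trans (gamma_own_series (le_n _)).
exact: gamma_mono.
Qed.

End Extension.
End Bound.

Lemma coherent_conditions (hcomm : algebraically_coherent C \/
    (commutator_independent_of_ambient C /\
     commutator_preserves_joins C /\ three_subobjects C)) :
  commutator_independent_of_ambient C /\
  commutator_preserves_joins C /\ three_subobjects C.
Proof.
case: hcomm => // hA; split; first exact: coherent_independent.
by split; [apply: coherent_joins|apply: coherent_three_subobjects].
Qed.

Section Main.
Hypothesis hind : commutator_independent_of_ambient C.
Hypothesis hjoin : commutator_preserves_joins C.
Hypothesis hthree : three_subobjects C.
Context {E B : C} (p : Hom E B) (N K : Sub E).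
Hypothesis hN : normal_sub N.
Hypothesis hK : is_kernel p (sub_mor K).
Hypothesis hKN : sub_le K (sub_comp (huq (sub_top N) (sub_top N))).

Lemma lower_central_le_own_series d : sub_is_zero (lower_central B d) ->
  sub_le (lower_central E d) (own_series N 1).
Proof.
move=> /sub_is_zeroP hB.
have [le _] := own_series_lower_central hind hN 1.
apply: sub_le_trans le; apply: sub_le_trans hKN; apply/sub_leP=> T u Hu.
apply/(proj1 (is_kernelP _ _) hK)/hB; apply/mem_preimage.
by move/sub_leP: (lower_central_preimage p d); apply.
Qed.

Lemma extension_bound c d :
  sub_is_zero (lower_central N (S c)) -> sub_is_zero (lower_central B (S d)) ->
  sub_is_zero (lower_central E (bound d (S c))).
Proof.
move=> hc /lower_central_le_own_series hd.
have H := lower_central_own_series hjoin hthree hN hd c.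
have [_ H'] := own_series_lower_central hind hN (S c).
exact: sub_is_zero_le (sub_le_trans H H') hc.
Qed.

(** A trivial quotient forces [E = [N, N]], and then all terms of the series
    of [N] are equal to [E]. *)
Lemma extension_of_zero c :
  sub_is_zero (lower_central B 0) -> sub_is_zero (lower_central N c) ->
  is_zero_object E.
Proof.
move=> /lower_central_le_own_series hd hc.
have H : sub_le (sub_top E) (own_series N c).
  have le1 : sub_le (own_series N 1) N by apply: huq_le_r.
  elim: (c) => [|i IH]; first exact: sub_le_trans le1.
  apply: (sub_le_trans hd); apply: huq_mono; first exact: sub_le_refl.
  exact: sub_le_trans (sub_le_top N) IH.
have [_ H'] := own_series_lower_central hind hN c.
exact: (sub_is_zero_le (S' := sub_comp (lower_central N c)) (sub_le_trans H H') hc).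
Qed.

End Main.

Lemma lower_central_zero_le (X : C) m n : m <= n ->
  sub_is_zero (lower_central X m) -> sub_is_zero (lower_central X n).
Proof. by move=> mn; apply/sub_is_zero_le/gamma_antitone => //; apply: normal_top. Qed.

Lemma zero_sub (X : C) (S : Sub X) : is_zero_object X -> sub_is_zero S.
Proof.
move=> /is_zero_objectP e; apply/sub_is_zeroP=> T u _.
by rewrite -(comp_id_l u) e zero_comp_l.
Qed.

Lemma nilpotency_class_exists (X : C) n : sub_is_zero (lower_central X n) ->
  exists e, nilpotency_class X e /\ e <= n.
Proof.
elim: n {-2}n (le_n n) => [|m IH] n Hn Zn.
  by exists n; split; [split=> // k _; lia|].
have [[k [Hk Zk]]|H] := classic (exists k, k < n /\ sub_is_zero (lower_central X k)).
  have [|e [He ek]] := IH k _ Zk; first by lia.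
  by exists e; split=> //; lia.
exists n; split=> //; split=> // k Zk.
by case: (Nat.le_gt_cases n k) => // kn; case: H; exists k.
Qed.

End SemiAbelian.

Local Open Scope sub_scope.

Theorem theorem3p4
    (C : Category) (hC : semi_abelian C)
    (hcomm : algebraically_coherent C \/
       (commutator_independent_of_ambient C /\
        commutator_preserves_joins C /\
        three_subobjects C))
    (E B : C) (p : Hom E B) (hp : is_regular_epi p) (hB : nilpotent B)
    (N : Sub E) (hN : normal_sub N) (hNnil : nilpotent (sub_obj N))
    (K : Sub E) (hK : is_kernel p (sub_mor K))
    (hKN : K ≤ sub_comp [sub_top (sub_obj N), sub_top (sub_obj N)]) :
  nilpotent E /\
  (* N = 0 with B <> 0 is excluded from the bound: then E is isomorphic to B,
     whereas the right-hand side is 0. *)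
  (forall c d : nat,
     nilpotency_class (sub_obj N) c -> nilpotency_class B d ->
     (0 < c)%nat \/ d = 0%nat ->
     exists e : nat,
       nilpotency_class E e /\
       (Z.of_nat e <=
        Z.of_nat c * (Z.of_nat c + 1) / 2 * (Z.of_nat d - 1) + Z.of_nat c)%Z).
Proof.
have [hind [hjoin hthree]] := coherent_conditions hC hcomm.
have ext := extension_bound hC hind hjoin hthree hN hK hKN.
split.
- case: hNnil => c Zc; case: hB => d Zd; exists (bound d (S c)).
  by apply: ext; apply: lower_central_zero_le (Nat.le_succ_diag_r _) _.
move=> c d [Zc minc] [Zd _] cd; case: d Zd cd => [|d] Zd cd.
- have ZE := extension_of_zero hC hind hN hK hKN Zd Zc.
  have c0 : (c <= 0)%nat.
    apply: minc; have : sub_is_zero N by apply: zero_sub ZE.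
    by [].
  exists 0%nat; split; first by split=> [|m _]; [exact: ZE|lia].
  have -> : c = 0%nat by lia.
  by [].
- case: c Zc minc cd => [|c] Zc minc cd; first by lia.
  have [e [He le]] := nilpotency_class_exists (ext c d Zc Zd).
  exists e; split=> //; move: le; rewrite /bound => le.
  have := inj_le _ _ le.
  rewrite Nat2Z.inj_add Nat2Z.inj_mul Nat2Z.inj_div Nat2Z.inj_mul Nat2Z.inj_add.
  have -> : (Z.of_nat (S d) - 1 = Z.of_nat d)%Z by lia.
  by [].
Qed.
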